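(* Let $p=2$ and let $g\in C^1([0,\infty))$ satisfy: $(g_1)$ $\lim_{s\to 0^+} g(s)/s$ exists and belongs to $[0,1)$; $(g_2)$ $\liminf_{s\to\infty} g(s)/s>1$; $(g_3')$ there exists a constant $u_0>0$ such that $g(u_0)=u_0$ and $g'(u_0)>\lambda_2^{\mathrm{rad}}$. Then the problem $-\Delta u+u=g(u)$ in $B$, $u>0$ in $B$, $\partial_\nu u=0$ on $\partial B$ admits an increasing (nonconstant) radial solution. Moreover, if $u_{0,1},\dots,u_{0,n}$ are $n$ distinct positive constants each satisfying $g(u_{0,i})=u_{0,i}$ and $g'(u_{0,i})>\lambda_2^{\mathrm{rad}}$, then the problem admits $n$ distinct increasing radial solutions.
   Context: $B$ is the open unit ball of $\mathbb R^N$, $N\ge1$, $\nu$ the outer unit normal on $\partial B$. $\lambda_2^{\mathrm{rad}}$ denotes the second eigenvalue of the operator $-\Delta+\mathbb I$ on $B$ with homogeneous Neumann boundary conditions restricted to radial functions (i.e. the second radial Neumann eigenvalue of $-\Delta u+u=\lambda u$ in $B$). Solutions are weak solutions in $H^1(B)$. *)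

(* Defs.v *)
From HB Require Import structures.
From mathcomp Require Import all_boot all_order all_algebra.
From mathcomp Require Import all_classical all_reals all_analysis.
Set Implicit Arguments. Unset Strict Implicit. Unset Printing Implicit Defensive.
Import Order.TTheory GRing.Theory Num.Theory.
Import numFieldNormedType.Exports.
Local Open Scope classical_set_scope.
Local Open Scope ring_scope.

Section Defs.
Variables (R : realType) (N : nat).

(* squared Euclidean norm on R^N (the library norm on 'rV is the sup norm) *)
Definition sqnorm (x : 'rV[R]_N) : R := \sum_(i < N) (x ord0 i) ^+ 2.
Definition eucl (x : 'rV[R]_N) : R := Num.sqrt (sqnorm x).

Definition ball_B : set 'rV[R]_N := [set x | sqnorm x < 1].
Definition cball_B : set 'rV[R]_N := [set x | sqnorm x <= 1].
Definition sphere_B : set 'rV[R]_N := [set x | sqnorm x = 1].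

Definition ebase (i : 'I_N) : 'rV[R]_N := delta_mx ord0 i.

Definition pd (i : 'I_N) (u : 'rV[R]_N -> R) : 'rV[R]_N -> R :=
  fun x => derive u x (ebase i).
Definition lap (u : 'rV[R]_N -> R) (x : 'rV[R]_N) : R :=
  \sum_(i < N) pd i (pd i u) x.

Definition C2_in_B_C1_up_to_bdry (u : 'rV[R]_N -> R) : Prop :=
  (forall x, ball_B x ->
     differentiable u x /\
     (forall i, differentiable (pd i u) x) /\
     (forall i j, {for x, continuous (pd j (pd i u))})) /\
  (forall x, cball_B x ->
     differentiable u x /\ (forall i, {for x, continuous (pd i u)})).

(* classical solution of  -Lap u + u = h(u) in B,  d_nu u = 0 on dB
   (outer normal at x in dB is x itself) *)
Definition neumann_sol (h : R -> R) (u : 'rV[R]_N -> R) : Prop :=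
  C2_in_B_C1_up_to_bdry u /\
  (forall x, ball_B x -> - lap u x + u x = h (u x)) /\
  (forall x, sphere_B x -> derive u x x = 0).

Definition radial (u : 'rV[R]_N -> R) : Prop :=
  exists v : R -> R, forall x, cball_B x -> u x = v (eucl x).

Definition increasing_radial (u : 'rV[R]_N -> R) : Prop :=
  exists v : R -> R,
    (forall x, cball_B x -> u x = v (eucl x)) /\
    (forall r s, 0 <= r -> r <= s -> s <= 1 -> v r <= v s) /\
    (exists r s, 0 <= r /\ r <= 1 /\ 0 <= s /\ s <= 1 /\ v r != v s).

Definition rad_eigenvalue (lam : R) : Prop :=
  exists phi : 'rV[R]_N -> R,
    radial phi /\ neumann_sol (fun s => lam * s) phi /\
    exists x, ball_B x /\ phi x != 0.

(* second radial eigenvalue: infimum of the radial eigenvalues that lie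
   strictly above some other radial eigenvalue (= second smallest one) *)
Definition lambda2_rad : R :=
  inf [set lam | rad_eigenvalue lam /\ exists mu, rad_eigenvalue mu /\ mu < lam].

Definition incr_rad_pos_sol (g : R -> R) (u : 'rV[R]_N -> R) : Prop :=
  neumann_sol g u /\ (forall x, ball_B x -> 0 < u x) /\ increasing_radial u.

End Defs.

Definition C1_halfline (R : realType) (g g' : R -> R) : Prop :=
  (forall s : R, 0 < s -> is_derive s 1 g (g' s)) /\
  ((fun h : R => h^-1 * (g h - g 0)) @ 0^'+ --> g' 0) /\
  {within [set s : R | 0 <= s], continuous g'}.

(* Main.v *)
Require Import Defs.
From HB Require Import structures.
From mathcomp Require Import all_boot all_order all_algebra.
From mathcomp Require Import all_classical all_reals all_analysis.
From mathcomp Require Import ring lra.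
Import Order.TTheory GRing.Theory Num.Theory.
Import numFieldNormedType.Exports.
Local Open Scope classical_set_scope.
Local Open Scope ring_scope.
Set Implicit Arguments.
Unset Strict Implicit.

(** Shooting method for radial solutions. With [N = n.+1], a radial solution
    [u(x) = v(|x|)] solves [(r^n v')' = r^n f(v)] with [f(s) = s - g(s)]; write
    [v' = r q]. Let [ds < u0] be the last zero of [f] before [u0], so that
    [f > 0] between them, and truncate [f] to a globally Lipschitz function.
    Solutions with [v(0) = d] exist and depend on [d] in a Lipschitz way, hence so
    does [mu(d) = min_[0,1] q]. For [d] close to [ds], [v] stays below [u0] and
    [mu(d) > 0]; for [d] close to [u0], a Wronskian comparison with a radial
    eigenfunction for an eigenvalue in [(1, g'(u0))] gives [mu(d) <= 0]. If
    [mu(d) = 0], then the zero of [q] is at [r = 1]: at [0] it would force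
    [f(d) = 0], and at an interior minimum uniqueness would make [v] constant.
    So [v] is increasing with [v'(1) = 0]. The hypothesis [(g2)] bounds [f] from
    above, hence [v], so the truncation is not seen. The intervals [(ds, u0)] of
    distinct [u0]'s are disjoint, so the solutions differ at the origin. *)

(** * One-variable calculus *)

(** The unknown [q = v' / r] is used because [v'] vanishes at [0] for every [d], so the minimum of
    [v'] on [[0, 1]] is never positive and cannot detect an increasing profile. In contrast [q]
    extends continuously with [n.+1 q(0) = f(d) > 0], and for [r > 0] the number [n.+1 q(r)] is a
    value of [f(v)] on []0, r[]. This mean value property replaces most estimates on integrals.
    Following the minimum of [q], rather than the first zero of [v'], leaves a plain intermediate
    value argument. Near [u0] the bound [f' < 1 - lam] makes the linearised equation oscillate
    faster than the eigenfunction, so [v'] cannot keep its sign over a whole monotone piece of it.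
    To extract such a [lam] from [lambda2_rad], the set under the infimum has to be nonempty and
    bounded below by [1]. An eigenvalue above [1] comes from a linear equation with a large
    coefficient, one of whose critical points is rescaled to [r = 1]. *)

Section Calculus.
Variable R : realType.
Implicit Types (f g h F G : R -> R) (x y a b : R).

(* A non-class copy of [is_derive]: side conditions stay goals instead of being
   sent to instance resolution. *)
Definition has_deriv f x a : Prop := is_derive x 1 f a.

Lemma has_deriv_val f x a b : has_deriv f x a -> a = b -> has_deriv f x b.
Proof. by move=> d <-. Qed.

Lemma has_deriv_cst (c x : R) : has_deriv (fun=> c) x (0 : R).
Proof. exact: is_derive_cst. Qed.

Lemma has_deriv_id x : has_deriv (fun t => t) x (1 : R).
Proof. exact: is_derive_id. Qed.

Lemma has_deriv_V f x a : f x != 0 -> has_deriv f x a ->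
  has_deriv (fun t => (f t)^-1) x (- (f x ^- 2 * a)).
Proof.
move=> f0 df; apply: (has_deriv_val (is_deriveV f0 df)).
by rewrite /GRing.scale/= mulNr.
Qed.

Lemma has_deriv_D f g x a b : has_deriv f x a -> has_deriv g x b ->
  has_deriv (fun t => f t + g t) x (a + b).
Proof. by move=> df dg; exact: is_deriveD. Qed.

Lemma has_deriv_B f g x a b : has_deriv f x a -> has_deriv g x b ->
  has_deriv (fun t => f t - g t) x (a - b).
Proof. by move=> df dg; exact: is_deriveB. Qed.

Lemma has_deriv_M f g x a b : has_deriv f x a -> has_deriv g x b ->
  has_deriv (fun t => f t * g t) x (a * g x + f x * b).
Proof.
move=> df dg; apply: (@is_derive_eq _ _ _ _ _ _ _ _ (is_deriveM df dg)).
by rewrite /GRing.scale/= addrC; congr (_ + _); rewrite mulrC.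
Qed.

Lemma has_deriv_Z f x (c a : R) : has_deriv f x a ->
  has_deriv (fun t => c * f t) x (c * a).
Proof. by move=> df; exact: (is_deriveZ c). Qed.

Lemma has_deriv_X (n : nat) x :
  has_deriv (fun t => t ^+ n) x (n%:R * x ^+ n.-1).
Proof.
apply: DeriveDef; first exact: exprn_derivable.
by rewrite exp_derive /GRing.scale/= mulr1.
Qed.

Lemma has_deriv_comp f g x a b : has_deriv f (g x) a ->
  has_deriv g x b -> has_deriv (fun t => f (g t)) x (a * b).
Proof. by move=> df dg; exact: (is_derive1_comp df dg). Qed.

Lemma has_deriv_near f g x a : (\forall t \near x, f t = g t) ->
  has_deriv f x a -> has_deriv g x a.
Proof. exact: near_eq_is_derive. Qed.

Lemma has_deriv_cont f x a : has_deriv f x a -> {for x, continuous f}.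
Proof.
move=> [df _]; apply: differentiable_continuous.
exact/derivable1_diffP.
Qed.

Lemma le_derive_itv F dF a b : a <= b -> {within `[a, b], continuous F} ->
  (forall x, x \in `]a, b[ -> has_deriv F x (dF x)) ->
  (forall x, x \in `]a, b[ -> 0 <= dF x) -> F a <= F b.
Proof.
rewrite le_eqVlt => /predU1P[-> //|ab] cF dFx dF0.
have [c cab e] := MVT ab dFx cF.
by rewrite -subr_ge0 e mulr_ge0 ?dF0 ?subr_ge0 ?ltW.
Qed.

Lemma lt_derive_itv F dF a b : a < b -> {within `[a, b], continuous F} ->
  (forall x, x \in `]a, b[ -> has_deriv F x (dF x)) ->
  (forall x, x \in `]a, b[ -> 0 < dF x) -> F a < F b.
Proof.
move=> ab cF dFx dF0; have [c cab e] := MVT ab dFx cF.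
by rewrite -subr_gt0 e mulr_gt0 ?dF0 ?subr_gt0.
Qed.

Lemma norm_le_derive F dF G dG b : 0 <= b ->
  {within `[0, b], continuous F} -> {within `[0, b], continuous G} ->
  (forall x, x \in `]0, b[ -> has_deriv F x (dF x)) ->
  (forall x, x \in `]0, b[ -> has_deriv G x (dG x)) ->
  (forall x, x \in `]0, b[ -> `|dF x| <= dG x) ->
  `|F 0| <= G 0 -> `|F b| <= G b.
Proof.
move=> b0 cF cG dFx dGx le; rewrite !ler_norml => /andP[l0 u0].
have : G 0 - F 0 <= G b - F b.
  apply: (@le_derive_itv (fun t => G t - F t) (fun t => dG t - dF t)) => //.
  - by move=> x; apply: continuousB; [exact: cG|exact: cF].
  - by move=> x xab; apply: has_deriv_B; [exact: dGx|exact: dFx].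
  - by move=> x /le; rewrite ler_norml => /andP[]; lra.
have : G 0 + F 0 <= G b + F b.
  apply: (@le_derive_itv (fun t => G t + F t) (fun t => dG t + dF t)) => //.
  - by move=> x; apply: continuousD; [exact: cG|exact: cF].
  - by move=> x xab; apply: has_deriv_D; [exact: dGx|exact: dFx].
  - by move=> x /le; rewrite ler_norml => /andP[]; lra.
by move=> /= h1 h2; apply/andP; split; lra.
Qed.

Lemma has_deriv_within f df a b :
  (forall x, a <= x -> has_deriv f x (df x)) -> {within `[a, b], continuous f}.
Proof.
move=> d; apply: derivable_within_continuous => x.
by rewrite in_itv/= => /andP[/d[]].
Qed.

(** The integral starts at [-1] so that [0] is an interior point, where the derivative is
    two-sided. *)
Lemma continuous_primitive h : continuous h ->
  exists F : R -> R, F 0 = 0 /\ forall x, -1 < x -> has_deriv F x (h x).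
Proof.
move=> ch.
have [G dG] : exists G : R -> R, forall x, -1 < x ->
    derivable G x 1 /\ 'D_1 G x = h x.
  eexists => x x1; rewrite -derive1E.
  have xx : x < x + 1 by rewrite ltrDl.
  apply: (@continuous_FTC1_closed R h (-1) x (x + 1) xx _ x1 (ch x)).
  apply: continuous_compact_integrable; first exact: segment_compact.
  exact: continuous_subspaceT.
have {}dG x : -1 < x -> has_deriv G x (h x).
  by move=> /dG[d e]; exact: (DeriveDef d e).
exists (fun x => G x - G 0); split; first by rewrite subrr.
move=> x /dG dx; rewrite -[h x]subr0; apply: has_deriv_B => //.
exact: has_deriv_cst.
Qed.

End Calculus.

(** * The radial initial value problem *)

Section RadialProfile.
Variables (R : realType) (n : nat).
Implicit Types (h v q : R -> R) (r x d : R).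

(** With [v' = r q], the equation [(r^n v')' = r^n h] reads [r q' + n.+1 q = h], and the last clause
    is its limit at [0]. The source [h] is a function of [r] alone, so the same predicate covers
    Picard iterates, differences of solutions and, with [h = f \o v], the nonlinear equation. *)
Definition radial_profile h v q : Prop :=
  [/\ forall r : R, 0 <= r -> has_deriv v r (r * q r),
      forall r : R, 0 < r -> has_deriv q r ((h r - n.+1%:R * q r) / r),
      continuous q & n.+1%:R * q 0 = h 0].

Let N_gt0 : 0 < n.+1%:R :> R. Proof. by rewrite ltr0n. Qed.

(** Rolle's theorem for [P - m t^(n+1)], where [m] is chosen to make both end values zero. The
    quotient is the average of [h] for the weight [t^n]. *)
Lemma radial_mean_value h (P : R -> R) r : 0 < r -> P 0 = 0 ->
  {within `[0, r], continuous P} ->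
  (forall x, x \in `]0, r[ -> has_deriv P x (x ^+ n * h x)) ->
  exists2 x, x \in `]0, r[ & n.+1%:R * (P r / r ^+ n.+1) = h x.
Proof.
move=> r0 P0 cP dP; set m := P r / r ^+ n.+1.
have dF x : x \in `]0, r[ -> has_deriv (fun t => P t - m * t ^+ n.+1) x
    (x ^+ n * h x - m * (n.+1%:R * x ^+ n)).
  by move=> xr; apply: has_deriv_B (dP _ xr) (has_deriv_Z _ (has_deriv_X _ _)).
have [x xr dFx] : exists2 x, x \in `]0, r[ &
    is_derive x 1 (fun t => P t - m * t ^+ n.+1) 0.
  apply: Rolle => //.
  - by move=> x /dF[].
  - move=> x; apply: cvgB; first exact: cP.
    move: x; apply: continuous_subspaceT => x.
    by apply: cvgM; [exact: cvg_cst|exact: exprn_continuous].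
  - by rewrite P0 expr0n/= mulr0 subr0 /m divfK ?subrr// expf_neq0// gt_eqF.
exists x => //; have [_ e] := dF x xr; have [_] := dFx; rewrite {}e.
have x0 : x ^+ n != 0.
  by move: xr; rewrite in_itv/= => /andP[x0 _]; rewrite expf_neq0// gt_eqF.
by move=> /eqP; rewrite subr_eq0 mulrA mulrC => /eqP /(mulIf x0) ->; rewrite mulrC.
Qed.

Lemma radial_profile_exists h d : continuous h ->
  exists v q, v 0 = d /\ radial_profile h v q.
Proof.
move=> ch.
have cXh : continuous (fun t : R => t ^+ n * h t).
  by move=> x; apply: cvgM; [exact: exprn_continuous|exact: ch].
have [P [P0 dP]] := continuous_primitive cXh.
have {}dP x : 0 <= x -> has_deriv P x (x ^+ n * h x).
  by move=> x0; apply: dP; apply: lt_le_trans x0; rewrite ltrN10.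
(* The constant on [r <= 0] is the limit of the quotient at [0^'+], so [q] is continuous on the
   whole line. *)
pose q r := if r <= 0 then h 0 / n.+1%:R else P r / r ^+ n.+1.
have dq r : 0 < r -> has_deriv q r ((h r - n.+1%:R * q r) / r).
  move=> r0.
  have rn0 : r ^+ n.+1 != 0 by rewrite expf_neq0// gt_eqF.
  apply: (@has_deriv_near _ (fun t => P t * (t ^+ n.+1)^-1)).
    near=> t; rewrite /q leNgt ifN// negbK.
    by near: t; exact: lt_nbhsr.
  apply: (has_deriv_val (has_deriv_M (dP _ (ltW r0))
    (has_deriv_V (f := fun t => t ^+ n.+1) rn0 (has_deriv_X n.+1 r)))).
  rewrite /q leNgt r0/=.
  rewrite !exprS in rn0 *; move: rn0; rewrite mulf_eq0 negb_or => /andP[r1 r2].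
  by field; rewrite r1 r2.
have cq : continuous q.
  move=> r; have [r0|r0|<-] := ltgtP 0 r.
  - exact: has_deriv_cont (dq _ r0).
  - have : {near r, (fun=> h 0 / n.+1%:R) =1 q}.
      near=> t; rewrite /q ifT//; apply/ltW; near: t; exact: lt_nbhsl.
    by move=> e; apply: (has_deriv_cont (has_deriv_near e _)); exact: has_deriv_cst.
  - rewrite /continuous_at {2}/q lexx; apply/cvgrPdist_le => e e0.
    have /cvgrPdist_le /(_ _ e0) [s /= s0 hs] := ch 0.
    near=> t; rewrite distrC /q; case: ifPn => [_|].
      by rewrite subrr normr0 ltW.
    rewrite -ltNge => t0.
    have [|x|x xt e1] := @radial_mean_value h P t t0 P0.
    - exact: has_deriv_within dP.
    - by rewrite in_itv/= => /andP[/ltW x0 _]; exact: dP.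
    have -> : P t / t ^+ n.+1 = h x / n.+1%:R by rewrite -e1 [RHS]mulrAC mulfV ?mul1r// gt_eqF.
    rewrite -mulrBl normrM normfV (gtr0_norm N_gt0) ler_pdivrMr//.
    rewrite distrC; apply: (@le_trans _ _ e); last by rewrite ler_peMr ?ler1n// ltW.
    apply: hs => /=; move: xt; rewrite in_itv/= => /andP[x0 xt].
    rewrite sub0r normrN gtr0_norm// (lt_trans xt)//.
    by near: t; exact: lt_nbhsl.
have cid : continuous (fun t : R => t * q t).
  by move=> x; apply: cvgM; [exact: cvg_id|exact: cq].
have [V [V0 dV]] := continuous_primitive cid.
exists (fun t => d + V t), q; split; first by rewrite V0 addr0.
split => //.
- move=> r r0; rewrite -[r * q r]add0r; apply: has_deriv_D.
    exact: has_deriv_cst.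
  by apply: dV; apply: lt_le_trans r0; rewrite ltrN10.
- by rewrite /q lexx mulrCA mulfV ?mulr1// gt_eqF.
Unshelve. all: by end_near. Qed.

Lemma has_deriv_flux h v q r : radial_profile h v q -> 0 < r ->
  has_deriv (fun t => t ^+ n.+1 * q t) r (r ^+ n * h r).
Proof.
move=> [_ dq _ _] r0.
apply: (has_deriv_val (has_deriv_M (has_deriv_X n.+1 r) (dq _ r0))).
rewrite exprS/=; by field; rewrite gt_eqF.
Qed.

Lemma flux_continuous h v q (A : set R) : radial_profile h v q ->
  {within A, continuous (fun t => t ^+ n.+1 * q t)}.
Proof.
move=> [_ _ cq _]; apply: continuous_subspaceT => x.
by apply: cvgM; [exact: exprn_continuous|exact: cq].
Qed.

Lemma radial_profile_mean h v q r : radial_profile h v q -> 0 < r ->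
  exists2 x, x \in `]0, r[ & n.+1%:R * q r = h x.
Proof.
move=> p r0; have [||x|x xr /= e] :=
  @radial_mean_value h (fun t => t ^+ n.+1 * q t) r r0.
- by rewrite expr0n/= mul0r.
- exact: flux_continuous p.
- by rewrite in_itv/= => /andP[x0 _]; exact: (has_deriv_flux p).
by exists x => //; rewrite -e (mulrAC (r ^+ _)) mulfV ?mul1r// expf_neq0// gt_eqF.
Qed.

Lemma radial_profileB h1 v1 q1 h2 v2 q2 :
  radial_profile h1 v1 q1 -> radial_profile h2 v2 q2 ->
  radial_profile (fun r => h1 r - h2 r) (fun r => v1 r - v2 r)
    (fun r => q1 r - q2 r).
Proof.
move=> [dv1 dq1 cq1 e1] [dv2 dq2 cq2 e2]; split.
- move=> r r0; apply: (has_deriv_val (has_deriv_B (dv1 _ r0) (dv2 _ r0))).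
  by rewrite mulrBr.
- move=> r r0; apply: (has_deriv_val (has_deriv_B (dq1 _ r0) (dq2 _ r0))).
  by by field; rewrite gt_eqF.
- by move=> x; apply: cvgB; [exact: cq1|exact: cq2].
- by rewrite mulrBr e1 e2.
Qed.

Lemma radial_profile_eq h1 h2 v q : (forall r, 0 <= r -> h1 r = h2 r) ->
  radial_profile h1 v q -> radial_profile h2 v q.
Proof.
move=> e [dv dq cq q0]; split => //; last by rewrite q0 e.
by move=> r r0; rewrite -e ?ltW//; exact: dq.
Qed.

Lemma has_deriv_expR (l r : R) :
  has_deriv (fun t => expR (l * t)) r (l * expR (l * r)).
Proof.
apply: (has_deriv_val (has_deriv_comp (f := expR) (is_derive_expR (l * r))
  (has_deriv_Z l (has_deriv_id r)))).
by rewrite mulr1 mulrC.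
Qed.

(** Two integrations each gain a factor [1 / l] against the weight [expR (l * r)]. A large [l] thus
    gives a contraction on [[0, rho]] without shrinking the interval. *)
Lemma radial_weighted_bound h v q (l c rho : R) : radial_profile h v q ->
  0 < l -> 0 <= c ->
  (forall r, 0 <= r <= rho -> `|h r| <= c * expR (l * r)) ->
  forall r, 0 <= r <= rho -> `|v r - v 0| <= c / l ^+ 2 * expR (l * r).
Proof.
move=> p l0 c0 hb r /andP[r0 rrho].
have dE x := has_deriv_expR l x.
have qb x : 0 < x <= rho -> `|x * q x| <= c / l * expR (l * x).
  move=> /andP[x0 xrho].
  have dG y : has_deriv (fun t => t ^+ n * (c / l * expR (l * t))) y
      (n%:R * y ^+ n.-1 * (c / l * expR (l * y)) + y ^+ n * (c * expR (l * y))).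
    apply: (has_deriv_val (has_deriv_M (has_deriv_X n y) (has_deriv_Z _ (dE y)))).
    by congr (_ + _ * _); rewrite mulrA divfK// gt_eqF.
  (* The derivative of the right side is [y^n c e^(l y)], which dominates the flux derivative, plus
     a nonnegative term from [y^n]. *)
  have : `|x ^+ n.+1 * q x| <= x ^+ n * (c / l * expR (l * x)).
    apply: (norm_le_derive (ltW x0) (flux_continuous p)
      (has_deriv_within (fun y _ => dG y)) _ (fun y _ => dG y)).
    - by move=> y; rewrite in_itv/= => /andP[y0 _]; exact: (has_deriv_flux p).
    - move=> y; rewrite in_itv/= => /andP[y0 yx].
      have yn (k : nat) : 0 <= y ^+ k by rewrite exprn_ge0// ltW.
      rewrite normrM (ger0_norm (yn n)) -[X in X <= _]add0r lerD//.
        by rewrite !mulr_ge0// ?invr_ge0 ?expR_ge0// ltW.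
      by rewrite ler_wpM2l// hb// ltW//= (le_trans (ltW yx)).
    - rewrite expr0n/= mul0r normr0 mulr_ge0 ?exprn_ge0//.
      by rewrite !mulr_ge0 ?invr_ge0 ?expR_ge0// ltW.
  have xn : 0 < x ^+ n by rewrite exprn_gt0.
  by rewrite exprSr -mulrA normrM (gtr0_norm xn) ler_pM2l.
have [dv _ _ _] := p.
have dF x : 0 <= x -> has_deriv (fun t => v t - v 0) x (x * q x).
  by move=> x0; rewrite -[x * q x]subr0; apply: has_deriv_B (dv _ x0) (has_deriv_cst _ _).
have dG x : has_deriv (fun t => c / l ^+ 2 * expR (l * t)) x (c / l * expR (l * x)).
  apply: (has_deriv_val (has_deriv_Z _ (dE x))).
  by by field; rewrite gt_eqF.
apply: (norm_le_derive (F := fun t => v t - v 0) r0 (has_deriv_within dF)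
  (has_deriv_within (fun x _ => dG x)) _ (fun x _ => dG x)).
- by move=> x; rewrite in_itv/= => /andP[x0 _]; exact: dF (ltW x0).
- move=> x; rewrite in_itv/= => /andP[x0 xr].
  by apply: qb; rewrite x0 (le_trans (ltW xr)).
- by rewrite subrr normr0 mulr_ge0 ?expR_ge0// divr_ge0// exprn_ge0// ltW.
Qed.

End RadialProfile.

(** * Picard iteration and continuous dependence on the initial value *)

Section Picard.
Variables (R : realType) (n : nat).
Implicit Types (f v q u : R -> R).

Lemma geometric_small (c e : R) : 0 < e -> exists k : nat, c / 4 ^+ k < e.
Proof.
move=> e0; exists (Num.bound `|c / e|); set k := Num.bound _.
rewrite ltr_pdivrMr ?exprn_gt0// mulrC -ltr_pdivrMr//.
apply: (@lt_le_trans _ _ k%:R).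
  by apply: le_lt_trans (ler_norm _) _; apply: archi_boundP.
by rewrite -natrX ler_nat ltnW// ltn_expl.
Qed.

(** The intervals of centre [a k] and radius [e k = 2 c / 4^k] are nested, since a step is at most
    [e k / 2] and [e k.+1 = e k / 4]. The limit is the supremum of their left ends. *)
Lemma geometric_limit (a : nat -> R) (c : R) :
  (forall k, `|a k.+1 - a k| <= c / 4 ^+ k) ->
  exists l, forall k, `|l - a k| <= 2 * c / 4 ^+ k.
Proof.
move=> ha.
pose e k : R := 2 * c / 4 ^+ k.
have c0 : 0 <= c by have := le_trans (normr_ge0 _) (ha 0%N); rewrite expr0 divr1.
have eE k : c / 4 ^+ k = e k / 2 by rewrite /e; field; rewrite expf_neq0.
have eS k : e k.+1 = e k / 4 by rewrite /e exprS; field; rewrite expf_neq0.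
have e0 k : 0 <= e k by rewrite /e !mulr_ge0// invr_ge0 exprn_ge0.
have step k : a k - e k <= a k.+1 - e k.+1 /\ a k.+1 + e k.+1 <= a k + e k.
  have := ha k; rewrite eE eS ler_norml => /andP[h1 h2].
  by have := e0 k; split; lra.
have incr i j : a i - e i <= a (i + j)%N - e (i + j)%N.
  elim: j => [|j IH]; first by rewrite addn0.
  by rewrite addnS; apply: le_trans IH _; have [] := step (i + j)%N.
have decr i j : a (i + j)%N + e (i + j)%N <= a i + e i.
  elim: j => [|j IH]; first by rewrite addn0.
  by rewrite addnS; apply: le_trans _ IH; have [] := step (i + j)%N.
have cross i j : a i - e i <= a j + e j.
  apply: le_trans (incr i j) _; apply: (@le_trans _ _ (a (i + j)%N + e (i + j)%N)).
    by have := e0 (i + j)%N; lra.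
  by rewrite addnC; exact: decr.
pose S := [set x | exists k, x = a k - e k].
have ub j : ubound S (a j + e j) by move=> _ [i ->].
have hs : has_sup S by split; [exists (a 0%N - e 0%N), 0%N|exists (a 0%N + e 0%N)].
exists (sup S) => k; rewrite -/(e k) ler_norml; apply/andP; split.
  by rewrite lerBrDl; apply: (ub_le_sup hs.2); exists k.
by rewrite lerBlDl; apply: ge_sup => //; exact: hs.1.
Qed.

(** An exponential weight for which the Picard map contracts by [1 / 4]; [L + 1] keeps it positive
    when [L = 0]. *)
Definition picard_rate (L : R) : R := 2 * (L + 1).

Lemma picard_rate_gt0 L : 0 <= L -> 0 < picard_rate L.
Proof. by rewrite /picard_rate => ?; lra. Qed.

Lemma picard_rateP L : 0 <= L -> L / picard_rate L ^+ 2 <= 4^-1.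
Proof.
move=> L0; have := picard_rate_gt0 L0 => l0.
rewrite ler_pdivrMr ?exprn_gt0// /picard_rate; nra.
Qed.

(** The contraction estimate, with inputs [u1], [u2] and outputs [v1], [v2]. The initial values may
    differ, so that the case [u = v] yields continuous dependence. *)
Lemma picard_step f v1 q1 u1 v2 q2 u2 (L c rho : R) : 0 <= L ->
  (forall x y, `|f x - f y| <= L * `|x - y|) ->
  radial_profile n (f \o u1) v1 q1 -> radial_profile n (f \o u2) v2 q2 ->
  0 <= c ->
  (forall r, 0 <= r <= rho -> `|u1 r - u2 r| <= c * expR (picard_rate L * r)) ->
  forall r, 0 <= r <= rho ->
  `|(v1 r - v2 r) - (v1 0 - v2 0)| <= c / 4 * expR (picard_rate L * r).
Proof.
move=> L0 Lf p1 p2 c0 hu r r0.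
have l0 := picard_rate_gt0 L0.
apply: le_trans (radial_weighted_bound (radial_profileB p1 p2) l0
  (mulr_ge0 L0 c0) _ r0) _.
  move=> x xr /=; apply: le_trans (Lf _ _) _.
  by rewrite -mulrA ler_wpM2l// hu.
rewrite ler_wpM2r ?expR_ge0// mulrAC mulrC ler_wpM2l//.
exact: picard_rateP.
Qed.

Lemma lipschitz_continuous f (L : R) : 0 <= L ->
  (forall x y, `|f x - f y| <= L * `|x - y|) -> continuous f.
Proof.
move=> L0 Lf x; apply/cvgrPdist_le => e e0.
have d0 : 0 < e / (L + 1) by rewrite divr_gt0// ltr_wpDl.
near=> t; apply: le_trans (Lf _ _) _.
have : `|x - t| <= e / (L + 1).
  by near: t; apply: cvgr_dist_le => //; exact: cvg_id.
rewrite ler_pdivlMr; last by rewrite ltr_wpDl.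
have := normr_ge0 (x - t); nra.
Unshelve. all: by end_near. Qed.

Lemma continuous_max0 f : (forall r : R, 0 <= r -> {for r, continuous f}) ->
  continuous (fun r : R => f (Num.max 0 r)).
Proof.
move=> cf r; apply: (@continuous_comp _ _ _ (fun r : R => Num.max 0 r) f).
  by apply: continuous_max; [exact: cvg_cst|exact: cvg_id].
by apply: cf; rewrite le_max lexx.
Qed.

Lemma radial_ode_exists f (L d : R) : 0 <= L ->
  (forall x y, `|f x - f y| <= L * `|x - y|) ->
  exists v q, v 0 = d /\ radial_profile n (f \o v) v q.
Proof.
move=> L0 Lf; have cf := lipschitz_continuous L0 Lf.
(* One Picard step. The output is frozen at its value in [0] for negative [r], because a profile
   controls [v] only for [r >= 0] while the next step asks for continuity on the whole line. A
   discontinuous [w] gets a dummy value. *)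
have step_exists (w : R -> R) : exists y : R -> R, continuous w ->
    exists v q, [/\ v 0 = d, radial_profile n (f \o w) v q &
      forall r, y r = v (Num.max 0 r)].
  have [cw|ncw] := pselect (continuous w); last by exists w.
  have cfw : continuous (f \o w).
    by move=> x; apply: continuous_comp; [exact: cw|exact: cf].
  have [v [q [v0 p]]] := radial_profile_exists n d cfw.
  by exists (fun r => v (Num.max 0 r)) => _; exists v, q.
have [T HT] := choice step_exists.
pose u k := iter k T (fun=> d).
have cu k : continuous (u k).
  elim: k => [|k IH]; first by move=> x; exact: cvg_cst.
  have [v [q [_ [dv _ _ _] Tv]]] := HT _ IH.
  rewrite (_ : u k.+1 = fun r => v (Num.max 0 r)); last exact/funext.
  apply: continuous_max0 => r r0; exact: has_deriv_cont (dv r r0).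
have uS k : exists v q, [/\ v 0 = d, radial_profile n (f \o u k) v q &
    forall r, u k.+1 r = v (Num.max 0 r)] by exact: HT (cu k).
set l : R := picard_rate L; have l0 : 0 < l := picard_rate_gt0 L0.
pose c : R := `|f d| / l ^+ 2.
have c0 : 0 <= c by rewrite divr_ge0 ?exprn_ge0// ltW.
have E1 (r : R) : 0 <= r -> 1 <= expR (l * r).
  by move=> r0; rewrite -expR0 ler_expR mulr_ge0// ltW.
have du k (r : R) : 0 <= r -> `|u k.+1 r - u k r| <= c / 4 ^+ k * expR (l * r).
  elim: k r => [|k IH] r r0.
    have [v [q [v0 p ->]]] := uS 0%N.
    rewrite (max_idPr r0) -[u 0%N r]/d -[in X in _ - X]v0 expr0 divr1.
    apply: (radial_weighted_bound (rho := r) p) => //; last by rewrite r0 lexx.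
    by move=> x /andP[x0 _]; rewrite /= ler_peMr// E1.
  have [v1 [q1 [v10 p1 ->]]] := uS k.+1.
  have [v2 [q2 [v20 p2 ->]]] := uS k.
  rewrite (max_idPr r0).
  have := @picard_step f v1 q1 _ v2 q2 _ L (c / 4 ^+ k) r L0 Lf p1 p2.
  rewrite v10 v20 subrr exprSr invfM mulrA => H; rewrite -[X in `|X|]subr0.
  apply: H; rewrite ?r0 ?lexx//; first by rewrite divr_ge0// exprn_ge0.
  by move=> x /andP[x0 _]; exact: IH.
have [U HU] : exists U : R -> R, forall (r : R) k, 0 <= r ->
    `|U r - u k r| <= 2 * c / 4 ^+ k * expR (l * r).
  have : forall r, exists y : R, 0 <= r ->
      forall k, `|y - u k r| <= 2 * c / 4 ^+ k * expR (l * r).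
    move=> r; have [r0|r0] := leP 0 r; last by exists 0.
    have [|y hy] := @geometric_limit (u ^~ r) (c * expR (l * r)).
      by move=> k; rewrite mulrAC; exact: du.
    by exists y => _ k; rewrite mulrAC -(mulrA 2).
  by move=> /choice[U HU]; exists U => r k r0; exact: HU.
pose W (r : R) := U (Num.max 0 r).
have cW : continuous W.
  move=> r; apply/cvgrPdist_le => e e0; rewrite /W.
  (* The convergence is uniform up to [|r| + 1], where the weight is at most [B]; hence an [e / 3]
     argument with one iterate. *)
  set B := expR (l * (`|r| + 1)).
  have [k hk] := @geometric_small (2 * c * B) (e / 3) (divr_gt0 e0 (ltr0n _ 3)).
  have [m mE] : exists m, m = fun t => u k (Num.max 0 t) by exists (fun t => u k (Num.max 0 t)).
  have cm : continuous m by rewrite mE; apply: continuous_max0 => t _; exact: cu.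
  have near_m t : t <= `|r| + 1 -> `|U (Num.max 0 t) - m t| <= e / 3.
    move=> tr; rewrite mE; apply: (le_trans (HU _ k _)); first by rewrite le_max lexx.
    apply: le_trans (ltW hk); rewrite (mulrAC _ B).
    have cB : 0 <= 2 * c / 4 ^+ k.
      by apply: divr_ge0; [exact: mulr_ge0|exact: exprn_ge0].
    by apply: (ler_wpM2l cB); rewrite ler_expR ler_pM2l// ge_max tr andbT addr_ge0.
  near=> t.
  have h1 := near_m r; have h2 : `|U (Num.max 0 t) - m t| <= e / 3.
    apply: near_m; apply/ltW; near: t; apply: lt_nbhsl.
    by have := ler_norm r; lra.
  have h3 : `|m r - m t| <= e / 3.
    by near: t; apply: cvgr_dist_le; [exact: cm|rewrite divr_gt0].
  have {}h1 : `|U (Num.max 0 r) - m r| <= e / 3.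
    by apply: h1; have := ler_norm r; lra.
  move: h1 h2 h3; rewrite !ler_norml => /andP[? ?] /andP[? ?] /andP[? ?].
  by apply/andP; split; lra.
have cfW : continuous (f \o W).
  by move=> x; apply: continuous_comp; [exact: cW|exact: cf].
(* Solve once more with source [f \o W]. Both [v] and [W] are close to the iterate [u k.+1] for
   every [k], so they agree on [r >= 0] and the source is [f \o v]. *)
have [v [q [v0 p]]] := radial_profile_exists n d cfW.
exists v, q; split=> //; apply: (radial_profile_eq _ p) => r r0 /=.
congr f; apply/eqP; rewrite /W (max_idPr r0) -subr_eq0 -normr_le0.
apply/ler_addgt0Pr => e e0; rewrite add0r.
have [k hk] := @geometric_small (2 * c * expR (l * r)) e e0.
apply: le_trans (ltW hk).
have [v2 [q2 [v20 p2 Tv2]]] := uS k.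
have := @picard_step f v q _ v2 q2 _ L (2 * c / 4 ^+ k) r L0 Lf p p2.
rewrite v0 v20 subrr => /(_ _ _ r) H.
have {}H : `|v r - v2 r| <= 2 * c / 4 ^+ k / 4 * expR (l * r).
  rewrite -[X in `|X|]subr0; apply: H; rewrite ?r0 ?lexx//.
    by apply: divr_ge0; [exact: mulr_ge0|exact: exprn_ge0].
  by move=> x /andP[x0 _]; rewrite /W (max_idPr x0); exact: HU.
pose y := 2 * c / 4 ^+ k * expR (l * r).
have H1 : `|v r - v2 r| <= y / 4.
  by apply: le_trans H _; rewrite /y [leRHS]mulrAC.
have H2 : `|U r - v2 r| <= y / 4.
  have := HU r k.+1 r0; rewrite Tv2 (max_idPr r0) exprSr invfM => /le_trans; apply.
  by rewrite /y !mulrA [leRHS]mulrAC.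
have -> : 2 * c * expR (l * r) / 4 ^+ k = y by rewrite /y mulrAC.
have y0 : 0 <= y by apply: le_trans (normr_ge0 _) _; exact: HU.
move: H1 H2; rewrite !ler_norml => /andP[? ?] /andP[? ?]; apply/andP; split; lra.
Unshelve. all: by end_near. Qed.

(** At a maximum point [m] of [D r = |v1 r - v2 r| e^(- l r)], the contraction estimate with
    [c = D m] bounds [D m] by the initial gap plus [D m / 4], so it can be absorbed. *)
Lemma radial_ode_dep f (L : R) v1 q1 v2 q2 : 0 <= L ->
  (forall x y, `|f x - f y| <= L * `|x - y|) ->
  radial_profile n (f \o v1) v1 q1 -> radial_profile n (f \o v2) v2 q2 ->
  forall r, 0 <= r <= 1 ->
    `|v1 r - v2 r| <= 2 * expR (picard_rate L) * `|v1 0 - v2 0|.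
Proof.
move=> L0 Lf p1 p2; set l : R := picard_rate L; have l0 : 0 < l := picard_rate_gt0 L0.
pose D r := `|v1 r - v2 r| / expR (l * r).
have cD : {within `[0, 1], continuous D}.
  have [dv1 _ _ _] := p1; have [dv2 _ _ _] := p2.
  have dD r (r0 : 0 <= r) := has_deriv_B (dv1 r r0) (dv2 r r0).
  move=> r; apply: cvgM.
    apply: cvg_norm; exact: (has_deriv_within (b := 1) dD).
  move: r; apply: continuous_subspaceT => r.
  apply: cvgV; first by rewrite gt_eqF// expR_gt0.
  exact: has_deriv_cont (has_deriv_expR l r).
have [m mI Dm] := EVT_max ler01 cD.
have m0 : 0 <= D m by rewrite divr_ge0 ?expR_ge0.
have DE r : `|v1 r - v2 r| = D r * expR (l * r).
  by rewrite /D divfK// gt_eqF// expR_gt0.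
have Dle r : 0 <= r <= 1 -> `|v1 r - v2 r| <= D m * expR (l * r).
  by move=> rI; rewrite DE ler_wpM2r ?expR_ge0// Dm// in_itv.
have mI' : 0 <= m <= 1 by rewrite in_itv/= in mI.
have H := picard_step L0 Lf p1 p2 m0 Dle mI'.
have E1 : 1 <= expR (l * m).
  by rewrite -expR0 ler_expR mulr_ge0 ?(ltW l0)//; case/andP: mI'.
have Dm2 : D m <= 2 * `|v1 0 - v2 0|.
  have h1 : D m * expR (l * m) <= `|v1 0 - v2 0| + D m / 4 * expR (l * m).
    rewrite -DE -lerBlDl; apply: le_trans H; exact: lerB_dist.
  set a := `|v1 0 - v2 0| in h1 *; have a0 : 0 <= a by exact: normr_ge0.
  nra.
move=> r rI; apply: le_trans (Dle r rI) _; rewrite [leRHS]mulrAC.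
apply: ler_pM => //.
rewrite ler_expR -[leRHS]mulr1 ler_pM2l//.
by case/andP: rI.
Qed.

End Picard.

(** * Radial functions on R^N *)

Lemma continuous_at_le (R : realType) (T : topologicalType) (a : T -> R) (x : T) :
  (forall e : R, 0 < e -> \forall y \near x, `|a x - a y| <= e) ->
  {for x, continuous a}.
Proof. by move=> H; apply/cvgrPdist_le. Qed.

Section ContinuousAt.
Variables (R : realType) (T : topologicalType) (a b : T -> R) (x : T).
Hypotheses (ca : {for x, continuous a}) (cb : {for x, continuous b}).

Lemma continuous_atM : {for x, continuous (fun y => a y * b y)}.
Proof. exact: cvgM. Qed.

Lemma continuous_atB : {for x, continuous (fun y => a y - b y)}.
Proof. exact: cvgB. Qed.

Lemma continuous_atD : {for x, continuous (fun y => a y + b y)}.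
Proof. exact: cvgD. Qed.

Lemma continuous_atV : a x != 0 -> {for x, continuous (fun y => (a y)^-1)}.
Proof. by move=> ax; exact: cvgV. Qed.

End ContinuousAt.

(** [F] is [o(h)], so its differential at [0] is zero. This serves at the origin, where the product
    rule fails because [eucl] is not differentiable. *)
Lemma differentiable_small (R : realType) (V W : normedModType R) (F : V -> W) :
  (forall e : R, 0 < e -> \forall h \near (0 : V), `|F h| <= e * `|h|) ->
  differentiable F 0.
Proof.
move=> H.
have F0 : F 0 = 0.
  have := H 1 ltr01 => /nbhs_singleton.
  by rewrite normr0 mulr0 normr_le0 => /eqP.
have D0 : F \o shift 0 = cst (F 0) + 0 +o_ 0 id.
  apply/eqaddoP => _/posnumP[e]; near=> h.
  rewrite /= !fctE F0 !addr0 subr0.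
  by near: h; exact: H.
have dF : 'd F 0 = 0 :> (V -> W).
  by apply/diff_unique => //; have [] := dcst (0 : W) (0 : V).
apply/diff_locallyP; rewrite dF; split => //.
by have [] := dcst (0 : W) (0 : V).
Unshelve. all: by end_near. Qed.

Section RadialFunctions.
Variables (R : realType) (n : nat).
Local Notation E := 'rV[R]_n.+1.
Implicit Types (x v : E) (f g q : R -> R).

Lemma dir_deriveE (F : E -> R) x v :
  derive F x v = 'D_1 (fun t : R => F (t *: v + x)) 0.
Proof.
rewrite /derive; set g1 := fun h => h^-1 *: _; set g2 := fun h => h^-1 *: _.
suff -> : g1 = g2 by [].
by rewrite funeqE /g1 /g2 => h /=; rewrite addr0 scale0r add0r [_%:A]mulr1.
Qed.

Lemma dir_deriv (F : E -> R) x v (a : R) :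
  has_deriv (fun t => F (t *: v + x)) 0 a -> derive F x v = a.
Proof. by move=> [_ e]; rewrite dir_deriveE. Qed.

Lemma has_deriv_dir (F : E -> R) x v : differentiable F x ->
  has_deriv (fun t => F (t *: v + x)) 0 (derive F x v).
Proof.
move=> dF; rewrite dir_deriveE; apply: derivableP.
by have /derivable1P := @diff_derivable _ _ _ _ _ v dF.
Qed.

Lemma sqnorm_shift x v (t : R) :
  sqnorm (t *: v + x) = t ^+ 2 * sqnorm v + t * (2 * \sum_i v ord0 i * x ord0 i)
    + sqnorm x.
Proof.
rewrite /sqnorm !mulr_sumr -!big_split/=; apply: eq_bigr => i _.
by rewrite !mxE; ring.
Qed.

Lemma sum_ebase x (i : 'I_n.+1) : \sum_j ebase R i ord0 j * x ord0 j = x ord0 i.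
Proof.
rewrite (bigD1 i)//= big1 ?addr0 => [|j ji]; rewrite /ebase mxE !eqxx/=.
  by rewrite mul1r.
by rewrite (negbTE ji) mul0r.
Qed.

Lemma sqnorm_ebase (i : 'I_n.+1) : sqnorm (ebase R i) = 1.
Proof.
rewrite /sqnorm (eq_bigr (fun j => ebase R i ord0 j * ebase R i ord0 j)).
  by rewrite sum_ebase mxE !eqxx.
by move=> j _; rewrite expr2.
Qed.

Lemma sqnorm_ge0 x : 0 <= sqnorm x.
Proof. by apply: sumr_ge0 => i _; exact: sqr_ge0. Qed.

Lemma sqnorm_gt0 x : x != 0 -> 0 < sqnorm x.
Proof.
move=> x0; rewrite lt_def sqnorm_ge0 andbT; apply: contra x0 => /eqP s0.
apply/eqP/rowP => i; rewrite mxE; apply/eqP.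
by rewrite -sqrf_eq0 (psumr_eq0P _ s0)// => j _; exact: sqr_ge0.
Qed.

Lemma sqnorm0 : sqnorm (0 : E) = 0.
Proof. by rewrite /sqnorm big1// => i _; rewrite mxE expr0n. Qed.

Lemma eucl_ge0 x : 0 <= eucl x. Proof. exact: sqrtr_ge0. Qed.

Lemma eucl_sqr x : eucl x ^+ 2 = sqnorm x.
Proof. by rewrite sqr_sqrtr// sqnorm_ge0. Qed.

Lemma eucl_gt0 x : x != 0 -> 0 < eucl x.
Proof. by move=> x0; rewrite sqrtr_gt0 sqnorm_gt0. Qed.

Lemma eucl0 : eucl (0 : E) = 0. Proof. by rewrite /eucl sqnorm0 sqrtr0. Qed.

Lemma coord_le_eucl x i : `|x ord0 i| <= eucl x.
Proof.
rewrite -sqrtr_sqr ler_sqrt ?sqnorm_ge0// /sqnorm (bigD1 i)//= lerDl.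
by apply: sumr_ge0 => j _; exact: sqr_ge0.
Qed.

Lemma coord_le_norm x i : `|x ord0 i| <= `|x|.
Proof.
have := @le_bigmax _ _ _ 0 (fun p : 'I_1 * 'I_n.+1 => `|x p.1 p.2|) (ord0, i).
by rewrite -mx_normrE.
Qed.

Lemma sqnorm_differentiable x : differentiable (@sqnorm R n.+1) x.
Proof.
have -> : @sqnorm R n.+1 = \sum_(i < n.+1) (fun y : E => y ord0 i ^+ 2).
  by apply/funext => y; rewrite fct_sumE.
apply: differentiable_sum => i.
have -> : (fun y : E => y ord0 i ^+ 2) = (fun y : E => y ord0 i) * (fun y : E => y ord0 i).
  by apply/funext => y; rewrite expr2.
by apply: differentiableM; exact: differentiable_coord.
Qed.

Lemma sqnorm_continuous : continuous (@sqnorm R n.+1).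
Proof. by move=> x; exact: differentiable_continuous (sqnorm_differentiable x). Qed.

Lemma eucl_continuous : continuous (@eucl R n.+1).
Proof.
move=> x; apply: (@continuous_comp _ _ _ (@sqnorm R n.+1) Num.sqrt).
  exact: sqnorm_continuous.
exact: sqrt_continuous.
Qed.

Lemma has_deriv_sqnorm_shift x v :
  has_deriv (fun t => sqnorm (t *: v + x)) 0 (2 * \sum_i v ord0 i * x ord0 i).
Proof.
set b := 2 * _; have H : has_deriv (fun t => t ^+ 2 * sqnorm v + t * b + sqnorm x) 0 b.
  apply: (has_deriv_val (has_deriv_D (has_deriv_D (has_deriv_M (has_deriv_X 2 0)
    (has_deriv_cst (sqnorm v) 0)) (has_deriv_M (has_deriv_id 0) (has_deriv_cst b 0)))
    (has_deriv_cst _ 0))).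
  by rewrite /= expr1 !mulr0 !mul0r mul1r !addr0 add0r.
by apply: has_deriv_near H; near=> t; rewrite sqnorm_shift.
Unshelve. all: by end_near. Qed.

(** Caratheodory's criterion: continuity of [k] is enough. It gives second derivatives where a
    factor is not known to be differentiable. *)
Lemma has_deriv_mul_id (k : R -> R) : {for 0, continuous k} ->
  has_deriv (fun t => t * k t) 0 (k 0).
Proof.
move=> ck; apply/is_derive1_caratheodory; exists k; split=> // z.
by rewrite mul0r !subr0 mulrC.
Qed.

End RadialFunctions.

(** * From a radial profile to a Neumann solution on the ball *)

Section RadialToNeumann.
Variables (R : realType) (n : nat) (h v q : R -> R).
Hypothesis p : radial_profile n h v q.
Hypothesis ch : forall r : R, 0 <= r -> {for r, continuous h}.
Local Notation E := 'rV[R]_n.+1.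
Implicit Types (x w : E).

(* Passing to the variable [s = r^2] makes the lift to the ball smooth at the
   origin: [v (eucl x) = V (sqnorm x)] with [V'] continuous up to [s = 0]. *)
Lemma radial_sq_primitive : exists V : R -> R,
  (forall s : R, 0 <= s -> has_deriv V s (q (Num.sqrt s) / 2)) /\
  (forall r : R, 0 <= r -> V (r ^+ 2) = v r).
Proof.
have [dv _ cq _] := p.
have cQ : continuous (fun s : R => q (Num.sqrt s) / 2).
  move=> s; apply: cvgM; last exact: cvg_cst.
  by apply: (@continuous_comp _ _ _ Num.sqrt q); [exact: sqrt_continuous|exact: cq].
have [P [P0 dP]] := continuous_primitive cQ.
have {}dP (s : R) : 0 <= s -> has_deriv P s (q (Num.sqrt s) / 2).
  by move=> s0; apply: dP; apply: lt_le_trans s0; rewrite ltrN10.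
have dV (s : R) : 0 <= s -> has_deriv (fun s => v 0 + P s) s (q (Num.sqrt s) / 2).
  by move=> s0; rewrite -[_ / 2]add0r; apply: has_deriv_D (has_deriv_cst _ _) (dP _ s0).
exists (fun s => v 0 + P s); split => // r r0.
have dF (x : R) : 0 <= x -> has_deriv (fun t => v 0 + P (t ^+ 2) - v t) x 0.
  move=> x0; apply: (has_deriv_val (has_deriv_B
    (has_deriv_comp (f := fun s => v 0 + P s) (g := fun t => t ^+ 2)
      (dV _ (sqr_ge0 x)) (has_deriv_X 2 x)) (dv _ x0))).
  by rewrite sqrtr_sqr ger0_norm//= expr1; field.
have : `|v 0 + P (r ^+ 2) - v r| <= 0.
  apply: (norm_le_derive (F := fun t => v 0 + P (t ^+ 2) - v t) (G := fun=> 0)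
    r0 (has_deriv_within dF) (has_deriv_within (fun (x : R) _ => has_deriv_cst 0 x)) _
    (fun (x : R) _ => has_deriv_cst 0 x)).
  - by move=> x; rewrite in_itv/= => /andP[x0 _]; exact: dF (ltW x0).
  - by move=> x _; rewrite normr0.
  - by rewrite expr0n/= P0 addr0 subrr normr0.
by rewrite normr_le0 subr_eq0 => /eqP.
Qed.

Let u (x : E) := v (eucl x).

Lemma lift_differentiable x : differentiable u x.
Proof.
have [V [dV Vv]] := radial_sq_primitive.
have -> : u = V \o @sqnorm R n.+1.
  by apply/funext => y /=; rewrite /u -Vv ?eucl_ge0// eucl_sqr.
apply: differentiable_comp; first exact: sqnorm_differentiable.
by have [d _] := dV _ (sqnorm_ge0 x); apply/derivable1_diffP.
Qed.

Lemma lift_dir x w : derive u x w = q (eucl x) * \sum_i w ord0 i * x ord0 i.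
Proof.
have [V [dV Vv]] := radial_sq_primitive.
have uV : u = fun y => V (sqnorm y).
  by apply/funext => y /=; rewrite /u -Vv ?eucl_ge0// eucl_sqr.
suff H : has_deriv (fun t => u (t *: w + x)) 0 (q (eucl x) * \sum_i w ord0 i * x ord0 i).
  exact: dir_deriv H.
rewrite uV; set b := \sum_i _.
have S0 : sqnorm (0 *: w + x) = sqnorm x by rewrite scale0r add0r.
have dVx : has_deriv V (sqnorm (0 *: w + x)) (q (eucl x) / 2).
  by rewrite S0; exact: dV (sqnorm_ge0 x).
apply: (has_deriv_val (has_deriv_comp dVx (has_deriv_sqnorm_shift x w))).
by rewrite -/b; field.
Qed.

Lemma lift_pd i : pd i u = fun x => x ord0 i * q (eucl x).
Proof. by apply/funext => x; rewrite /pd lift_dir sum_ebase mulrC. Qed.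

Lemma qeucl_continuous : continuous (fun x : E => q (eucl x)).
Proof.
have [_ _ cq _] := p => x.
by apply: (@continuous_comp _ _ _ (@eucl R n.+1) q); [exact: eucl_continuous|exact: cq].
Qed.

Lemma lift_pd_continuous i : continuous (pd i u).
Proof.
move=> x; rewrite lift_pd; apply: continuous_atM; last exact: qeucl_continuous.
exact: (@coord_continuous R 1 n.+1 ord0 i x).
Qed.

Lemma lift_pd_differentiable i x : differentiable (pd i u) x.
Proof.
have [_ dq cq _] := p; rewrite lift_pd.
have [->|x0] := eqVneq x 0; last first.
  apply: (@differentiableM _ _ (fun y : E => y ord0 i) (fun y : E => q (eucl y))).
    exact: differentiable_coord.
  apply: (@differentiable_comp _ _ _ _ (@eucl R n.+1) q).
    apply: (@differentiable_comp _ _ _ _ (@sqnorm R n.+1) Num.sqrt).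
      exact: sqnorm_differentiable.
    by apply/derivable1_diffP; have [d _] := is_derive1_sqrt (sqnorm_gt0 x0).
  by apply/derivable1_diffP; have [d _] := dq _ (eucl_gt0 x0).
(* At the origin, split off the linear part [x_i q(0)]; the remainder is [o(|x|)] by continuity of
   [q]. *)
have -> : (fun x => x ord0 i * q (eucl x)) =
    (fun x => x ord0 i * q 0) + (fun x => x ord0 i * (q (eucl x) - q 0)).
  by apply/funext => y; rewrite /= !fctE -mulrDr addrC subrK.
apply: differentiableD.
  apply: (@differentiableM _ _ (fun y : E => y ord0 i) (cst (q 0))) => //.
  exact: differentiable_coord.
apply: differentiable_small => e e0; near=> y.
rewrite normrM mulrC ler_pM// ?coord_le_norm// distrC.
have : `|q (eucl (0 : E)) - q (eucl y)| <= e.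
  by near: y; apply: cvgr_dist_le e0; exact: qeucl_continuous.
by rewrite eucl0.
Unshelve. all: by end_near. Qed.

(* At [x = 0] the fraction is [0 / 0 = 0], which is the right value. *)
Definition lift_hess (i j : 'I_n.+1) x : R := (i == j)%:R * q (eucl x) +
  x ord0 i * x ord0 j / sqnorm x * (h (eucl x) - n.+1%:R * q (eucl x)).

Lemma lift_pd_pd i j : pd j (pd i u) = lift_hess i j.
Proof.
have [_ dq cq _] := p.
apply/funext => x; rewrite lift_pd /pd.
suff H : has_deriv (fun t => (t *: ebase R j + x) ord0 i * q (eucl (t *: ebase R j + x))) 0
    (lift_hess i j x) by exact: (dir_deriv (F := fun y : E => y ord0 i * q (eucl y)) H).
have cE t : (t *: ebase R j + x) ord0 i = t * (i == j)%:R + x ord0 i.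
  by rewrite !mxE eqxx.
have S0 : sqnorm (0 *: ebase R j + x) = sqnorm x by rewrite scale0r add0r.
rewrite /lift_hess; have [x0|x0] := eqVneq x 0.
  apply: (@has_deriv_near _ (fun t => t * ((i == j)%:R * q (eucl (t *: ebase R j + x))))).
    by near=> t; rewrite cE x0 mxE !addr0 mulrA.
  rewrite x0 mxE !mul0r addr0.
  apply: (has_deriv_val (has_deriv_mul_id _)); last by rewrite scale0r add0r.
  apply: continuous_atM; first exact: cst_continuous.
  apply: (@continuous_comp _ _ _ (fun t : R => t *: ebase R j + 0) (fun y : E => q (eucl y))).
    by apply: cvgD; [apply: cvgZr_tmp; exact: cvg_id|exact: cvg_cst].
  exact: qeucl_continuous.
have e0 := eucl_gt0 x0.
have dC : has_deriv (fun t => (t *: ebase R j + x) ord0 i) 0 (i == j)%:R.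
  apply: (@has_deriv_near _ (fun t => t * (i == j)%:R + x ord0 i)).
    by near=> t; rewrite cE.
  apply: (has_deriv_val (has_deriv_D
    (has_deriv_M (has_deriv_id 0) (has_deriv_cst _ 0)) (has_deriv_cst _ 0))).
  by rewrite mul1r mul0r !addr0.
have dS : has_deriv Num.sqrt (sqnorm (0 *: ebase R j + x)) (2 * eucl x)^-1.
  by rewrite S0; exact: is_derive1_sqrt (sqnorm_gt0 x0).
have dS2 := has_deriv_comp dS (has_deriv_sqnorm_shift x (ebase R j)).
have dQ : has_deriv q (Num.sqrt (sqnorm (0 *: ebase R j + x)))
    ((h (eucl x) - n.+1%:R * q (eucl x)) / eucl x).
  by rewrite S0; exact: dq.
have dQ2 := has_deriv_comp (f := q)
  (g := fun t => Num.sqrt (sqnorm (t *: ebase R j + x))) dQ dS2.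
apply: (has_deriv_val (has_deriv_M dC dQ2)).
rewrite sum_ebase scale0r add0r -/(eucl x) -eucl_sqr.
by field; rewrite gt_eqF.
Unshelve. all: by end_near. Qed.

Lemma lift_hess_continuous i j : continuous (lift_hess i j).
Proof.
have [_ _ cq q0] := p.
have ce x : {for x, continuous (fun x : E => h (eucl x) - n.+1%:R * q (eucl x))}.
  apply: continuous_atB.
    apply: (@continuous_comp _ _ _ (@eucl R n.+1) h); first exact: eucl_continuous.
    exact: ch (eucl_ge0 x).
  by apply: continuous_atM; [exact: cst_continuous|exact: qeucl_continuous].
move=> x; apply: (@continuous_atD R E (fun x => (i == j)%:R * q (eucl x))
  (fun x => x ord0 i * x ord0 j / sqnorm x * (h (eucl x) - n.+1%:R * q (eucl x)))).
  by apply: continuous_atM; [exact: cst_continuous|exact: qeucl_continuous].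
have [->|x0] := eqVneq x 0; last first.
  apply: continuous_atM; last exact: ce.
  apply: continuous_atM.
    by apply: continuous_atM; exact: (@coord_continuous R 1 n.+1 ord0 _ x).
  by apply: continuous_atV; [exact: sqnorm_continuous|rewrite gt_eqF// sqnorm_gt0].
(* The quotient [y_i y_j / |y|^2] has no limit at the origin but is bounded by [1], and its factor
   [h - n.+1 q] tends to [h 0 - n.+1 q(0) = 0]. *)
apply: continuous_at_le => e e0; near=> y.
rewrite eucl0 q0 subrr mulr0 sub0r normrN normrM.
have h1 : `|y ord0 i * y ord0 j / sqnorm y| <= 1.
  have [->|y0] := eqVneq y 0; first by rewrite !mxE !mul0r normr0.
  have s0 := sqnorm_gt0 y0.
  rewrite normrM normfV (gtr0_norm s0) ler_pdivrMr// mul1r normrM -eucl_sqr expr2.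
  by rewrite ler_pM// coord_le_eucl.
have h2 : `|h (eucl y) - n.+1%:R * q (eucl y)| <= e.
  have : `|(h (eucl (0:E)) - n.+1%:R * q (eucl (0:E))) - (h (eucl y) - n.+1%:R * q (eucl y))| <= e.
    by near: y; apply: cvgr_dist_le e0; exact: ce.
  by rewrite eucl0 q0 subrr sub0r normrN.
by rewrite -[e]mul1r ler_pM.
Unshelve. all: by end_near. Qed.

(** Trace of [lift_hess]: the coefficients [x_i^2 / |x|^2] sum to [1] off the origin, and
    [n.+1 q(0) = h 0] settles the origin. *)
Lemma lift_lap x : lap u x = h (eucl x).
Proof.
have [_ _ _ q0] := p.
rewrite /lap (eq_bigr (fun i => q (eucl x) + (x ord0 i) ^+ 2 *
  ((h (eucl x) - n.+1%:R * q (eucl x)) / sqnorm x))); last first.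
  move=> i _; rewrite lift_pd_pd /lift_hess eqxx mul1r expr2; congr (_ + _).
  by rewrite mulrAC mulrA.
rewrite big_split/= sumr_const card_ord -mulr_suml -/(sqnorm x).
have [->|x0] := eqVneq x 0.
  by rewrite eucl0 sqnorm0 mul0r addr0 -q0 mulr_natl.
rewrite mulrC divfK ?gt_eqF ?sqnorm_gt0// -[_ *+ n.+1]mulr_natl; ring.
Qed.

Lemma lift_neumann (g : R -> R) : q 1 = 0 ->
  (forall r, 0 <= r < 1 -> h r = v r - g (v r)) -> neumann_sol g u.
Proof.
move=> q1 hg; split; [split|split].
- move=> x _; split; first exact: lift_differentiable.
  split; first by move=> i; exact: lift_pd_differentiable.
  by move=> i j; rewrite lift_pd_pd; exact: lift_hess_continuous.
- move=> x _; split; first exact: lift_differentiable.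
  by move=> i; exact: lift_pd_continuous.
- move=> x xB; rewrite lift_lap hg /u; first by rewrite opprB subrK.
  by rewrite eucl_ge0 -sqrtr1 ltr_sqrt.
- move=> x xS; rewrite lift_dir /eucl.
  have -> : sqnorm x = 1 by [].
  by rewrite sqrtr1 q1 mul0r.
Qed.

End RadialToNeumann.

(** * From a radial Neumann eigenfunction to an ordinary differential equation on a ray *)

Section NeumannToRadial.
Variables (R : realType) (n : nat) (lam : R) (phi : 'rV[R]_n.+1 -> R).
Hypothesis rphi : radial phi.
Hypothesis sol : neumann_sol (fun s => lam * s) phi.
Local Notation E := 'rV[R]_n.+1.
Local Notation e0 := (ebase R (ord0 : 'I_n.+1)).
Implicit Types (x : E) (r t : R).

(** The function [v] in [radial] carries no regularity; the restriction of [phi] to a coordinate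
    axis is a profile that inherits that of [phi]. *)
Definition axis_val r := phi (r *: e0).
Definition axis_der r := pd ord0 phi (r *: e0).

Lemma eucl_axis r : 0 <= r -> eucl (r *: e0) = r.
Proof.
move=> r0; rewrite /eucl -[r *: e0]addr0 sqnorm_shift sqnorm_ebase sqnorm0 mulr1 addr0.
by rewrite big1 ?mulr0 ?addr0 ?sqrtr_sqr ?ger0_norm// => i _; rewrite [(0 : E) _ _]mxE mulr0.
Qed.

Lemma sqnorm_axis r : sqnorm (r *: e0) = r ^+ 2.
Proof.
rewrite -[r *: e0]addr0 sqnorm_shift sqnorm_ebase sqnorm0 mulr1 addr0.
by rewrite big1 ?mulr0 ?addr0// => i _; rewrite [(0 : E) _ _]mxE mulr0.
Qed.

Lemma axis_cball r : 0 <= r <= 1 -> cball_B (r *: e0).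
Proof. by move=> /andP[r0 r1]; rewrite /cball_B/= sqnorm_axis expr_le1. Qed.

Lemma axis_ball r : 0 <= r < 1 -> ball_B (r *: e0).
Proof. by move=> /andP[r0 r1]; rewrite /ball_B/= sqnorm_axis expr_lt1. Qed.

Lemma eucl_le1 x : cball_B x -> eucl x <= 1.
Proof. by rewrite /cball_B/= => x1; rewrite -sqrtr1 ler_sqrt. Qed.

Lemma phi_axis_val x : cball_B x -> phi x = axis_val (eucl x).
Proof.
move=> xB; have [v hv] := rphi; rewrite /axis_val !hv//.
  by rewrite eucl_axis// eucl_ge0.
by apply: axis_cball; rewrite eucl_ge0 eucl_le1.
Qed.

Lemma axis_comp_continuous (F : E -> R) r : {for (r *: e0), continuous F} ->
  {for r, continuous (fun t => F (t *: e0))}.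
Proof.
move=> cF; apply: (@continuous_comp _ _ _ (fun t : R => t *: e0) F); last exact: cF.
by apply: cvgZr_tmp; exact: cvg_id.
Qed.

Lemma has_deriv_axis (F : E -> R) r : differentiable F (r *: e0) ->
  has_deriv (fun t => F (t *: e0)) r (derive F (r *: e0) e0).
Proof.
move=> dF; have := has_deriv_dir e0 dF => D.
have D' : has_deriv (fun t => F (t *: e0 + r *: e0)) (r - r) (derive F (r *: e0) e0).
  by rewrite subrr.
have dsub := has_deriv_B (has_deriv_id r) (has_deriv_cst r r).
apply: (@has_deriv_near _ (fun t => F ((t - r) *: e0 + r *: e0))).
  by near=> t; rewrite -scalerDl subrK.
apply: (has_deriv_val (has_deriv_comp (f := fun t => F (t *: e0 + r *: e0))
  (g := fun t => t - r) D' dsub)).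
by rewrite subr0 mulr1.
Unshelve. all: by end_near. Qed.

Lemma has_deriv_axis_val r : 0 <= r <= 1 -> has_deriv axis_val r (axis_der r).
Proof.
move=> rI; have [[_ H] _] := sol; have [dphi _] := H _ (axis_cball rI).
exact: has_deriv_axis dphi.
Qed.

Lemma axis_der_continuous r : 0 <= r <= 1 -> {for r, continuous axis_der}.
Proof.
move=> rI; have [[_ H] _] := sol; have [_ cpd] := H _ (axis_cball rI).
exact: axis_comp_continuous (cpd ord0).
Qed.

Lemma has_deriv_axis_der r : 0 <= r < 1 ->
  has_deriv axis_der r (pd ord0 (pd ord0 phi) (r *: e0)).
Proof.
move=> rI; have [[H _] _] := sol; have [_ [dpd _]] := H _ (axis_ball rI).
exact: has_deriv_axis (dpd ord0).
Qed.

Lemma axis_der1 : axis_der 1 = 0.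
Proof.
have [_ [_ H]] := sol; rewrite /axis_der /pd scale1r; apply: H.
by rewrite /sphere_B/= sqnorm_ebase.
Qed.

(** A radial function is even along the axis, so its derivative at the origin equals its own
    opposite. *)
Lemma axis_der0 : axis_der 0 = 0.
Proof.
have d := has_deriv_axis_val (r := 0); rewrite lexx ler01 in d.
have d0 := d isT; have even : \forall t \near 0, axis_val (- t) = axis_val t.
  near=> t; have t1 : `|t| <= 1.
    rewrite -[t]opprK normrN -[- t]add0r.
    by near: t; apply: (@cvgr_dist_le _ _ _ _ _ id) => //; exact: cvg_id.
  have B : sqnorm (t *: e0) <= 1 by rewrite sqnorm_axis -real_normK ?num_real// expr_le1.
  have eE : eucl (- t *: e0) = eucl (t *: e0) by rewrite /eucl !sqnorm_axis sqrrN.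
  rewrite /axis_val (phi_axis_val B) phi_axis_val ?eE//.
  by rewrite /cball_B/= sqnorm_axis sqrrN -sqnorm_axis.
have dN : has_deriv axis_val 0 (- axis_der 0).
  apply: (has_deriv_near even).
  have dopp := has_deriv_Z (-1) (has_deriv_id (0 : R)).
  have d0' : has_deriv axis_val (-1 * 0) (axis_der 0) by rewrite mulr0.
  apply: (@has_deriv_near _ (fun t => axis_val (-1 * t))).
    by near=> t; rewrite mulN1r.
  apply: (has_deriv_val (has_deriv_comp (f := axis_val) (g := fun t => -1 * t) d0' dopp)).
  by rewrite mulr1 mulrN1.
have [_ e1] := d0; have [_ e2] := dN.
by move: e2; rewrite e1 => /eqP; rewrite -subr_eq0 opprK -mulr2n mulrn_eq0/= => /eqP.
Unshelve. all: by end_near. Qed.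

Lemma pd_radial x i : x != 0 -> ball_B x ->
  pd i phi x = axis_der (eucl x) / eucl x * x ord0 i.
Proof.
move=> x0 xB; have ex := eucl_gt0 x0.
have S0 : sqnorm (0 *: ebase R i + x) = sqnorm x by rewrite scale0r add0r.
have dS : has_deriv Num.sqrt (sqnorm (0 *: ebase R i + x)) (2 * eucl x)^-1.
  by rewrite S0; exact: is_derive1_sqrt (sqnorm_gt0 x0).
have dV : has_deriv axis_val (Num.sqrt (sqnorm (0 *: ebase R i + x))) (axis_der (eucl x)).
  rewrite S0; apply: has_deriv_axis_val; rewrite eucl_ge0/= eucl_le1//.
  exact: ltW.
have D := has_deriv_comp (f := axis_val)
  (g := fun t => Num.sqrt (sqnorm (t *: ebase R i + x))) dV
  (has_deriv_comp (f := Num.sqrt) (g := fun t => sqnorm (t *: ebase R i + x)) dS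
    (has_deriv_sqnorm_shift x (ebase R i))).
have D2 : has_deriv (fun t => phi (t *: ebase R i + x)) 0
    (axis_der (eucl x) / eucl x * x ord0 i).
  have cS := has_deriv_cont (has_deriv_sqnorm_shift x (ebase R i)).
  have lt1 : sqnorm (0 *: ebase R i + x) < 1 by rewrite S0.
  apply: (has_deriv_val (has_deriv_near _ D)).
    near=> t; rewrite phi_axis_val// /cball_B/= ltW//.
    by near: t; apply: (cS _ (lt_nbhsl lt1)).
  by rewrite sum_ebase; field; rewrite gt_eqF.
exact: dir_deriv D2.
Unshelve. all: by end_near. Qed.

(** At transverse displacement [t] from the axis, [pd_radial] writes [pd i phi] as [t] times a
    continuous function, whose value at [t = 0] is the derivative. *)
Lemma pd_pd_axis r i : 0 < r < 1 -> i != ord0 ->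
  pd i (pd i phi) (r *: e0) = axis_der r / r.
Proof.
move=> /andP[r0 r1] i0; set a := r *: e0.
have ai : a ord0 i = 0 by rewrite !mxE (negbTE i0) mulr0.
have a0 : a != 0.
  by apply/eqP => /(congr1 (@eucl R n.+1)); rewrite eucl_axis ?ltW// eucl0 => /eqP; rewrite gt_eqF.
pose c t := t *: ebase R i + a.
have cc : {for 0, continuous c}.
  by apply: cvgD; [apply: cvgZr_tmp; exact: cvg_id|exact: cvg_cst].
have c0 : c 0 = a by rewrite /c scale0r add0r.
have sq_c : {for 0, continuous (fun t => sqnorm (c t))}.
  exact: has_deriv_cont (has_deriv_sqnorm_shift a (ebase R i)).
have Sc : sqnorm (c 0) = r ^+ 2 by rewrite c0 sqnorm_axis.
have D : has_deriv (fun t => pd i phi (c t)) 0 (axis_der r / r).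
  apply: (@has_deriv_near _ (fun t => t * (axis_der (eucl (c t)) / eucl (c t)))).
    near=> t.
    have ct0 : c t != 0.
      apply: contraTneq isT => e; have : 0 < sqnorm (c t).
        by near: t; apply: (sq_c _ (lt_nbhsr _)); rewrite Sc exprn_gt0.
      by rewrite e sqnorm0 ltxx.
    rewrite pd_radial//; last first.
      by near: t; apply: (sq_c _ (lt_nbhsl _)); rewrite Sc expr_lt1// ltW.
    by rewrite {3}/c !mxE (negbTE i0) mulr0 addr0 !eqxx mulr1 mulrC.
  have ec : {for 0, continuous (fun t => eucl (c t))}.
    by apply: (@continuous_comp _ _ _ c (@eucl R n.+1)) => //; exact: eucl_continuous.
  have e00 : eucl (c 0) = r by rewrite c0 eucl_axis// ltW.
  apply: (has_deriv_val (has_deriv_mul_id (k := fun t => axis_der (eucl (c t)) / eucl (c t)) _)).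
    apply: continuous_atM.
      apply: (@continuous_comp _ _ _ (fun t => eucl (c t)) axis_der) => //.
      by rewrite e00; apply: axis_der_continuous; rewrite !ltW.
    by apply: continuous_atV => //; rewrite e00 gt_eqF.
  by rewrite e00.
exact: dir_deriv D.
Unshelve. all: by end_near. Qed.

Lemma has_deriv_axis_flux r : 0 < r < 1 ->
  has_deriv (fun t => t ^+ n * axis_der t) r ((1 - lam) * (r ^+ n * axis_val r)).
Proof.
move=> rI; have /andP[r0 r1] := rI.
have rI' : 0 <= r < 1 by rewrite ltW.
apply: (has_deriv_val (has_deriv_M (has_deriv_X n r) (has_deriv_axis_der rI'))).
have [_ [H _]] := sol; have := H _ (axis_ball rI').
rewrite /lap (bigD1 ord0)//= (eq_bigr (fun=> axis_der r / r)); last first.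
  by move=> i i0; exact: pd_pd_axis.
rewrite sumr_const cardC1 card_ord /= -/(axis_val r) => e.
set d2 := pd ord0 (pd ord0 phi) (r *: e0) in e *.
have {e} -> : d2 = (1 - lam) * axis_val r - n%:R * (axis_der r / r).
  by move: e; rewrite -[_ *+ n]mulr_natl => e; lra.
case: n => [|m]; first by rewrite !mul0r expr0; ring.
by rewrite exprS/=; field; rewrite gt_eqF.
Qed.

End NeumannToRadial.

(** * Consecutive zeros *)

Section Clamp.
Variable R : realType.
Implicit Types (f : R -> R) (a b r t : R).

Definition clamp a b t : R := Num.max a (Num.min t b).

Lemma clamp_itv a b t : a <= b -> a <= clamp a b t <= b.
Proof. by move=> ab; rewrite /clamp le_max lexx/= ge_max ab ge_min lexx orbT. Qed.

Lemma clamp_id a b t : a <= t <= b -> clamp a b t = t.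
Proof. by move=> /andP[at_ tb]; rewrite /clamp (min_idPl tb) (max_idPr at_). Qed.

Lemma clamp_continuous a b : continuous (clamp a b).
Proof.
move=> t; rewrite /clamp.
apply: (@continuous_max _ _ (fun=> a) (fun t => Num.min t b)); first exact: cvg_cst.
by apply: (@continuous_min _ _ id (fun=> b)); [exact: cvg_id|exact: cvg_cst].
Qed.

Lemma clamp_dist a b t r : a <= b -> `|clamp a b t - clamp a b r| <= `|t - r|.
Proof.
move=> ab; rewrite /clamp.
wlog tr : t r / t <= r => [H|].
  by have [/H//|/ltW/H] := leP t r; rewrite distrC (distrC r).
rewrite distrC (distrC t) [leRHS]ger0_norm ?subr_ge0// ler_norml.
by case: (leP t b) => ?; case: (leP r b) => ?; case: (leP a t) => ?;
  case: (leP a r) => ?; case: (leP a b) => ?; apply/andP; split; lra.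
Qed.

Lemma continuous_clamp f a b : a <= b -> {within `[a, b], continuous f} ->
  continuous (fun t => f (clamp a b t)).
Proof.
move=> ab /subspace_continuousP cf t.
have tI : `[a, b]%classic (clamp a b t) by rewrite /= in_itv/= clamp_itv.
move=> P /(cf _ tI) H.
have H' : \forall s \near clamp a b t, `[a, b]%classic s -> P (f s) by exact: H.
have K : \forall s \near t, `[a, b]%classic (clamp a b s) -> P (f (clamp a b s)).
  exact: (@clamp_continuous a b t _ H').
suff : \forall s \near t, P (f (clamp a b s)) by [].
by apply: filterS K => s; apply; rewrite /= in_itv/= clamp_itv.
Qed.

(** The zero set in [[a, r]] is compact, so it has a maximum [c]; a nonnegative value after [c]
    would create a later zero. Used for the truncation level [ds] and for the monotone pieces of
    eigenfunctions. *)
Lemma last_zero f a r : a < r -> {within `[a, r], continuous f} ->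
  f a = 0 -> f r < 0 ->
  exists c, [/\ a <= c, c < r, f c = 0 & forall t, c < t <= r -> f t < 0].
Proof.
move=> ar cf fa fr.
have cF := continuous_clamp (ltW ar) cf; set F := (fun t => _) in cF.
have FE t : a <= t <= r -> F t = f t by move=> tI; rewrite /F clamp_id.
pose A := `[a, r]%classic `&` F @^-1` [set 0].
have cA : compact A.
  apply: (@subclosed_compact _ _ `[a, r]%classic); [|exact: segment_compact|exact: subIsetl].
  apply: closedI; first exact: itv_closed.
  by apply: closed_comp => [x _|]; [exact: cF|exact: closed_eq].
have A0 : A !=set0.
  by exists a; split; rewrite /= ?in_itv/= ?lexx ?(ltW ar)// FE ?lexx ?(ltW ar).
have cid : {within A, continuous (@id R)}.
  by apply: continuous_subspaceT => x; exact: cvg_id.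
have [c cA' cmax] := compact_EVT_max A0 cA cid.
move: cA'; rewrite inE => -[]; rewrite /= in_itv/= => cI Fc.
have fc : f c = 0 by rewrite -FE.
have /andP[ac cr] := cI.
have cr' : c < r.
  by rewrite lt_neqAle cr andbT; apply: contraTneq fr => <-; rewrite fc ltxx.
exists c; split => // t /andP[ct tr]; rewrite ltNge; apply/negP => ft.
have tI : a <= t <= r by rewrite (le_trans ac (ltW ct)).
have /(_ _ _)[||s sI fs] := @IVT R f t r 0 tr.
- by apply: continuous_subspaceW cf => s /=; rewrite !in_itv/= => /andP[ts ->];
    rewrite (le_trans _ ts)//; case/andP: tI.
- by rewrite ge_min le_max (ltW fr) ft orbT.
move: sI; rewrite in_itv/= => /andP[ts sr].
have sI : a <= s <= r by rewrite sr andbT (le_trans _ ts)//; case/andP: tI.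
have := cmax s; rewrite inE => /(_ _); rewrite leNgt (lt_le_trans ct ts) => H.
by apply/notF/H; split; rewrite /= ?in_itv//= FE.
Qed.

Lemma first_zero f r b : r < b -> {within `[r, b], continuous f} ->
  f b = 0 -> f r < 0 ->
  exists c, [/\ r < c, c <= b, f c = 0 & forall t, r <= t < c -> f t < 0].
Proof.
move=> rb cf fb fr.
have cN : {within `[- b, - r], continuous (fun t => f (- t))}.
  have cF := continuous_clamp (ltW rb) cf.
  apply: (@subspace_eq_continuous _ _ _ (fun t => f (clamp r b (- t)))).
    move=> t; rewrite inE/= in_itv/= => /andP[bt tr].
    by rewrite clamp_id// lerNr tr lerNl bt.
  apply: continuous_subspaceT => t.
  apply: (@continuous_comp _ _ _ (fun t : R => - t) (fun t => f (clamp r b t))).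
    exact: opp_continuous.
  exact: cF.
have rbN : - b < - r by rewrite ltrN2.
have fbN : f (- - b) = 0 by rewrite opprK.
have frN : f (- - r) < 0 by rewrite opprK.
have [c [bc cr fc fneg]] := last_zero rbN cN fbN frN.
exists (- c); split; rewrite ?opprK//; [by rewrite ltrNr|by rewrite lerNl|].
move=> t /andP[rt tc]; rewrite -[t]opprK; apply: fneg.
by rewrite ltrNr tc lerN2.
Qed.

End Clamp.

(** * Radial eigenvalues *)

Section RadialEigenvalues.
Variables (R : realType) (n : nat).
Implicit Types (lam k r t : R).

Lemma eigen_nonzero lam (phi : 'rV[R]_n.+1 -> R) : radial phi ->
  neumann_sol (fun s => lam * s) phi -> (exists x, ball_B x /\ phi x != 0) ->
  exists2 r, 0 < r < 1 & axis_val phi r != 0.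
Proof.
move=> rp sol [x [xB px]].
have xC : cball_B x by apply/ltW.
have e1 : eucl x < 1 by rewrite -sqrtr1 ltr_sqrt.
move: px; rewrite (phi_axis_val rp xC) => px.
have [e0|e0] := eqVneq (eucl x) 0; last first.
  by exists (eucl x) => //; rewrite e1 andbT lt_def e0 eucl_ge0.
have c0 : {for 0, continuous (axis_val phi)}.
  by apply: has_deriv_cont (has_deriv_axis_val sol _); rewrite lexx ler01.
rewrite e0 in px.
have pos : 0 < `|axis_val phi 0| by rewrite normr_gt0.
have := c0; rewrite /prop_for /continuous_at => /cvgrPdist_lt /(_ _ pos) H.
have H' : \forall t \near 0^'+, `|axis_val phi 0 - axis_val phi t| < `|axis_val phi 0|.
  by apply: cvg_within H.
near (0 : R)^'+ => t; exists t.
  by apply/andP; split; near: t; [exact: nbhs_right_gt|exact: nbhs_right_lt].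
have : `|axis_val phi 0 - axis_val phi t| < `|axis_val phi 0| by near: t.
by apply: contraTneq => ->; rewrite subr0 ltxx.
Unshelve. all: by end_near. Qed.

Lemma axis_flux_continuous lam (phi : 'rV[R]_n.+1 -> R) a b :
  neumann_sol (fun s => lam * s) phi -> 0 <= a -> b <= 1 ->
  {within `[a, b], continuous (fun t => t ^+ n * axis_der phi t)} /\
  {within `[a, b], continuous (axis_val phi)}.
Proof.
move=> sol a0 b1.
have I t : t \in `[a, b]%classic -> 0 <= t <= 1.
  by rewrite inE/= in_itv/= => /andP[at_ tb]; rewrite (le_trans a0 at_) (le_trans tb b1).
split; apply: continuous_in_subspaceT => t /I tI.
  apply: (@continuous_atM R R (fun t => t ^+ n) (axis_der phi)).
    exact: exprn_continuous.
  by have := axis_der_continuous sol tI.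
exact: has_deriv_cont (has_deriv_axis_val sol tI).
Qed.

(* Energy identity: [(r^n v v')' = r^n ((1 - lam) v^2 + v'^2)], and both ends vanish. *)
Lemma rad_eigenvalue_ge1 lam : rad_eigenvalue n.+1 lam -> 1 <= lam.
Proof.
move=> [phi [rp [sol nz]]]; rewrite leNgt; apply/negP => lam1.
have [s /andP[s0 s1] vs] := eigen_nonzero rp sol nz.
set v := axis_val phi in vs *; set y := axis_der phi.
pose F t := (t ^+ n * y t) * v t.
pose dF t := (1 - lam) * (t ^+ n * v t) * v t + (t ^+ n * y t) * y t.
have dFx t : 0 < t < 1 -> has_deriv F t (dF t).
  move=> tI; have /andP[t0 t1] := tI.
  have tI' : 0 <= t <= 1 by rewrite !ltW.
  exact: (has_deriv_val (has_deriv_M (has_deriv_axis_flux rp sol tI)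
    (has_deriv_axis_val sol tI'))).
have dF0 t : 0 < t < 1 -> 0 <= dF t.
  move=> /andP[t0 t1]; have tn : 0 <= t ^+ n by rewrite exprn_ge0// ltW.
  rewrite /dF -!mulrA addr_ge0//; last by rewrite mulr_ge0// -expr2 sqr_ge0.
  by rewrite mulr_ge0 ?subr_ge0 ?(ltW lam1)// mulr_ge0// -expr2 sqr_ge0.
have cF a b : 0 <= a -> b <= 1 -> {within `[a, b], continuous F}.
  move=> a0 b1; have [c1 c2] := axis_flux_continuous sol a0 b1.
  by move=> t; apply: cvgM; [exact: c1|exact: c2].
have F0 : F 0 = 0 by rewrite /F /y (axis_der0 rp sol) mulr0 mul0r.
have F1 : F 1 = 0 by rewrite /F /y (axis_der1 sol) mulr0 mul0r.
have Fz t : 0 < t < 1 -> F t = 0.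
  move=> /andP[t0 t1]; apply/eqP; rewrite eq_le; apply/andP; split.
    rewrite -F1; apply: (le_derive_itv (dF := dF) (ltW t1)).
    - exact: cF (ltW t0) (lexx _).
    - by move=> x; rewrite in_itv/= => /andP[tx x1]; apply: dFx; rewrite x1 (lt_trans t0).
    - by move=> x; rewrite in_itv/= => /andP[tx x1]; apply: dF0; rewrite x1 (lt_trans t0).
  rewrite -F0; apply: (le_derive_itv (dF := dF) (ltW t0)).
  - exact: cF (lexx _) (ltW t1).
  - by move=> x; rewrite in_itv/= => /andP[x0 xt]; apply: dFx; rewrite x0 (lt_trans xt).
  - by move=> x; rewrite in_itv/= => /andP[x0 xt]; apply: dF0; rewrite x0 (lt_trans xt).
(* [F] vanishes on []0, 1[], so its derivative at [s] is [0], whereas [dF s > 0] because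
   [v s != 0]. *)
have [_ ds] : is_derive s 1 F 0.
  apply: (@derive1_at_max _ F 0 1 s ler01).
  - by move=> t; rewrite in_itv/= => /dFx[].
  - by rewrite in_itv/= s0.
  - by move=> t; rewrite in_itv/= => tI; rewrite !Fz ?s0.
have [|_] := dFx s; first by rewrite s0.
rewrite ds => /esym/eqP; apply/negP; rewrite gt_eqF// /dF -!mulrA.
have sn : 0 < s ^+ n by rewrite exprn_gt0.
rewrite ltr_pwDl//; last by rewrite mulr_ge0 ?(ltW sn)// -expr2 sqr_ge0.
by rewrite mulr_gt0 ?subr_gt0// mulr_gt0// -expr2 exprn_even_gt0.
Qed.

Lemma radial_lift (v : R -> R) : radial (fun x : 'rV[R]_n.+1 => v (eucl x)).
Proof. by exists v. Qed.

Lemma rad_eigenvalue1 : rad_eigenvalue (R := R) n.+1 1.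
Proof.
have p : radial_profile n (fun=> 0) (fun=> 1) (fun=> 0 : R).
  split=> [r _|r r0||]; last by rewrite mulr0.
  - by rewrite mulr0; exact: has_deriv_cst.
  - by rewrite mulr0 subr0 mul0r; exact: has_deriv_cst.
  - by move=> x; exact: cvg_cst.
exists (fun=> 1); split; [exact: (radial_lift (fun=> 1))|split].
  by apply: (lift_neumann p) => // [r _|r _]; [exact: cvg_cst|rewrite mul1r subrr].
by exists 0; rewrite /ball_B/= sqnorm0 oner_neq0.
Qed.

Lemma has_deriv_radial_der h v q r : radial_profile n h v q -> 0 < r ->
  has_deriv (fun t => t * q t) r (h r - n%:R * q r).
Proof.
move=> [_ dq _ _] r0.
apply: (has_deriv_val (has_deriv_M (has_deriv_id r) (dq r r0))).
by rewrite -natr1; field; rewrite gt_eqF.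
Qed.

(* Rolle's theorem for [k v eta + v' eta'], where
   [eta = ((r - 1/2)(1 - r))^2] satisfies [k eta + eta'' - (n/r) eta' > 0]. *)
Lemma linear_critical_point v q (k := (2 * n%:R + 12) ^+ 2 : R) :
  radial_profile n (fun r => - k * v r) v q -> exists2 c, 1 / 2 < c < 1 & q c = 0.
Proof.
move=> p; have [dv dq cq q0] := p.
pose y t : R := (t - 1 / 2) * (1 - t).
pose y' t : R := 3 / 2 - 2 * t.
have dy t : has_deriv y t (y' t).
  apply: (has_deriv_val (has_deriv_M (has_deriv_B (has_deriv_id t) (has_deriv_cst _ t))
    (has_deriv_B (has_deriv_cst _ t) (has_deriv_id t)))).
  by rewrite /y'; field.
have dy' t : has_deriv y' t (- 2).
  apply: (has_deriv_val (has_deriv_B (has_deriv_cst _ t) (has_deriv_Z 2 (has_deriv_id t)))).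
  by ring.
pose W t := k * v t * (y t * y t) + t * q t * (2 * (y t * y' t)).
pose K t := k * (y t * y t) - n%:R / t * (2 * (y t * y' t)) + 2 * (y' t * y' t - 2 * y t).
have dW t : 0 < t -> has_deriv W t (t * q t * K t).
  move=> t0; have d1 := has_deriv_M (has_deriv_Z k (dv t (ltW t0))) (has_deriv_M (dy t) (dy t)).
  have d2 := has_deriv_M (has_deriv_radial_der p t0)
    (has_deriv_Z 2 (has_deriv_M (dy t) (dy' t))).
  apply: (has_deriv_val (has_deriv_D d1 d2)).
  by rewrite /K; field; rewrite gt_eqF.
have h0 : 0 < 1 / 2 :> R by rewrite divr_gt0.
have [|t|||c] := @Rolle R W (1 / 2) 1.
- by rewrite ltr_pdivrMr// mul1r ltr1n.
- by rewrite in_itv/= => /andP[/(lt_trans h0) /dW[]].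
- by apply: (has_deriv_within (df := fun t => t * q t * K t)) => t /(lt_le_trans h0); exact: dW.
- by rewrite /W /y !subrr !(mul0r, mulr0) !addr0.
rewrite in_itv/= => /andP[c1 c2] [_ e1]; exists c; first by rewrite c1.
have c0 := lt_trans h0 c1; have [_] := dW c c0; rewrite e1 => /esym/eqP.
have Kpos : 0 < K c.
  have yc : 0 < y c by rewrite /y mulr_gt0 ?subr_gt0.
  have nc : n%:R / c <= 2 * n%:R :> R.
    by rewrite ler_pdivrMr//; have := ler0n R n; nra.
  have nc0 : 0 <= n%:R / c :> R by rewrite divr_ge0 ?ler0n// ltW.
  have y'y : y' c * y' c = 1 / 4 - 4 * y c by rewrite /y /y'; field.
  have y'le : y' c <= 1 / 2 by rewrite /y'; lra.
  have h1 : n%:R / c * (2 * (y c * y' c)) <= 2 * n%:R * y c.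
    have h2 : 2 * (y c * y' c) <= y c by nra.
    apply: le_trans (ler_wpM2l nc0 h2) _.
    by rewrite ler_wpM2r// ltW.
  (* The choice of [k] makes [K c] at least [z^2 - z + 1/2 = (z - 1/2)^2 + 1/4]: the term [2 n y]
     bounds the first-order part, as [c > 1/2], and [12 y] comes from [eta'']. *)
  rewrite /K y'y /k; set z := (2 * n%:R + 12) * y c.
  have -> : (2 * n%:R + 12) ^+ 2 * (y c * y c) = z ^+ 2 by rewrite /z; ring.
  have : 0 <= (z - 1 / 2) ^+ 2 by exact: sqr_ge0.
  move: h1; set w := n%:R / c * _ => h1.
  have : z = 2 * n%:R * y c + 12 * y c by rewrite /z; ring.
  by rewrite sqrrB => h3 h4; lra.
by rewrite mulf_eq0 (gt_eqF Kpos) orbF mulf_eq0 (gt_eqF c0)/= => /eqP.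
Qed.

Lemma radial_profile_scale h v q c : 0 < c -> radial_profile n h v q ->
  radial_profile n (fun r => c ^+ 2 * h (c * r)) (fun r => v (c * r))
    (fun r => c ^+ 2 * q (c * r)).
Proof.
move=> c0 [dv dq cq q0]; split.
- move=> r r0; have cr : 0 <= c * r by rewrite mulr_ge0// ltW.
  apply: (has_deriv_val (has_deriv_comp (f := v) (g := fun t => c * t) (dv _ cr)
    (has_deriv_Z c (has_deriv_id r)))); ring.
- move=> r r0; have cr : 0 < c * r by rewrite mulr_gt0.
  apply: (has_deriv_val (has_deriv_Z (c ^+ 2) (has_deriv_comp (f := q)
    (g := fun t => c * t) (dq _ cr) (has_deriv_Z c (has_deriv_id r))))).
  by field; rewrite (gt_eqF c0) (gt_eqF r0).
- move=> r; apply: (@continuous_atM R R (fun=> c ^+ 2) (fun r => q (c * r))).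
    exact: cst_continuous.
  apply: (@continuous_comp _ _ _ (fun t => c * t) q); last exact: cq.
  by apply: (@continuous_atM R R (fun=> c) id); [exact: cst_continuous|exact: cvg_id].
- by rewrite mulr0 mulrCA q0.
Qed.

(** Shoot [(r^n v')' = - k r^n v] from [v(0) = 1], take a critical point [c] in []1/2, 1[], and
    rescale it to radius [1]. The coefficient becomes [k c^2]. *)
Lemma rad_eigenvalue_gt1 : exists lam : R, rad_eigenvalue n.+1 lam /\ 1 < lam.
Proof.
pose k : R := (2 * n%:R + 12) ^+ 2.
have k0 : 0 < k by rewrite exprn_gt0// ltr_wpDl ?mulr_ge0.
have [|v [q [v0 p]]] := @radial_ode_exists R n (fun s => - k * s) k 1 (ltW k0).
  by move=> x y; rewrite -mulrBr normrM normrN (gtr0_norm k0).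
have [c /andP[c1 c2] qc] := linear_critical_point p.
have c0 : 0 < c by apply: lt_trans c1; rewrite divr_gt0.
have ps := radial_profile_scale c0 p.
exists (1 + k * c ^+ 2); split; last by rewrite ltrDl mulr_gt0// exprn_gt0.
exists (fun x => v (c * eucl x)); split; first exact: (radial_lift (fun r => v (c * r))).
split.
  apply: (lift_neumann ps).
  - move=> r r0; have [dv _ _ _] := ps.
    apply: (@continuous_atM R R (fun=> c ^+ 2) (fun r => - k * v (c * r))).
      exact: cst_continuous.
    apply: (@continuous_atM R R (fun=> - k) (fun r => v (c * r))).
      exact: cst_continuous.
    exact: has_deriv_cont (dv r r0).
  - by rewrite mulr1 qc mulr0.
  - by move=> r _ /=; ring.
by exists 0; rewrite /ball_B/= sqnorm0 eucl0 mulr0 v0 oner_neq0.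
Qed.

(** The infimum of an empty set would be a mere default value, hence the appeal to an eigenvalue
    above [1]. An element of the set exceeds some eigenvalue [mu >= 1]. *)
Lemma lambda2_rad_lt (s : R) : lambda2_rad R n.+1 < s ->
  exists lam, [/\ rad_eigenvalue n.+1 lam, 1 < lam & lam < s].
Proof.
rewrite /lambda2_rad; set S := [set lam | _] => sS.
have S0 : S !=set0.
  have [lam [el l1]] := rad_eigenvalue_gt1.
  by exists lam; split => //; exists 1; split => //; exact: rad_eigenvalue1.
have lbS : has_lbound S by exists 1 => lam [/rad_eigenvalue_ge1].
have e0 : 0 < s - inf S by rewrite subr_gt0.
have [lam [el [mu [emu mulam]]] lams] := inf_adherent e0 (conj S0 lbS).
exists lam; split => //; first exact: le_lt_trans (rad_eigenvalue_ge1 emu) mulam.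
by rewrite addrC subrK in lams.
Qed.

(* Between consecutive zeros of [v'] with [v' < 0], Rolle's theorem for
   [r^n v'] gives a zero of [v], whence the signs at the end points. *)
Lemma eigen_decreasing_interval lam : rad_eigenvalue n.+1 lam -> 1 < lam ->
  exists v y : R -> R, exists a b : R,
  [/\ 0 <= a, a < b & b <= 1] /\
  [/\ forall r, 0 < r < 1 -> has_deriv v r (y r),
      forall r, 0 < r < 1 ->
        has_deriv (fun t => t ^+ n * y t) r ((1 - lam) * (r ^+ n * v r)),
      {within `[a, b], continuous v} &
      {within `[a, b], continuous (fun t => t ^+ n * y t)}] /\
  [/\ forall r, a < r < b -> y r < 0, y a = 0, y b = 0, 0 <= v a & v b <= 0].
Proof.
move=> [phi [rp [sol nz]]] lam1.
have [s sI vs] := eigen_nonzero rp sol nz.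
(* If [v'] were zero on []0, 1[], so would be [(r^n v')' = (1 - lam) r^n v], against [v s != 0]. *)
have [r rI yr] : exists2 r, 0 < r < 1 & axis_der phi r != 0.
  apply: contrapT => H.
  have y0 t : 0 < t < 1 -> axis_der phi t = 0.
    move=> tI; apply: contrapT => /eqP yt; apply: H; by exists t.
  have D := has_deriv_axis_flux rp sol sI.
  have Z : has_deriv (fun t => t ^+ n * axis_der phi t) s 0.
    have /andP[s0 s1] := sI.
    apply: (@has_deriv_near _ (fun=> 0)); last exact: has_deriv_cst.
    near=> t; rewrite y0 ?mulr0//; apply/andP; split; near: t.
      exact: lt_nbhsr.
    exact: lt_nbhsl.
  have [_ e1] := D; have [_ e2] := Z; move: e2; rewrite e1 => /eqP.
  rewrite !mulf_eq0 (negbTE vs) orbF subr_eq0 (lt_eqF lam1)/=.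
  by apply/negP; rewrite expf_neq0// gt_eqF//; case/andP: sI.
have /andP[r0 r1] := rI.
(* The sign of the eigenfunction is normalised to make [v'] negative at [r]. *)
pose sg : R := - Num.sg (axis_der phi r).
pose v t := sg * axis_val phi t; pose y t := sg * axis_der phi t.
have yneg : y r < 0.
  by rewrite /y /sg mulNr -normrEsg oppr_lt0 normr_gt0.
have y0 : y 0 = 0 by rewrite /y (axis_der0 rp sol) mulr0.
have y1 : y 1 = 0 by rewrite /y (axis_der1 sol) mulr0.
have cy t : 0 <= t <= 1 -> {for t, continuous y}.
  move=> tI; apply: (@continuous_atM R R (fun=> sg) (axis_der phi)).
    exact: cst_continuous.
  by have := axis_der_continuous sol tI.
have cv t : 0 <= t <= 1 -> {for t, continuous v}.
  move=> tI; apply: (@continuous_atM R R (fun=> sg) (axis_val phi)).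
    exact: cst_continuous.
  exact: has_deriv_cont (has_deriv_axis_val sol tI).
have cw (f : R -> R) a b : (forall t, 0 <= t <= 1 -> {for t, continuous f}) ->
    0 <= a -> b <= 1 -> {within `[a, b], continuous f}.
  move=> cf a0 b1; apply: continuous_in_subspaceT => t.
  rewrite inE/= in_itv/= => /andP[at_ tb]; apply: cf.
  by rewrite (le_trans a0 at_) (le_trans tb b1).
have [a [a0 ar ya aneg]] := last_zero r0 (cw _ _ _ cy (lexx _) (ltW r1)) y0 yneg.
have [b [rb b1 yb bneg]] := first_zero r1 (cw _ _ _ cy (ltW r0) (lexx _)) y1 yneg.
have ab := lt_trans ar rb.
have neg t : a < t < b -> y t < 0.
  move=> /andP[at_ tb]; have [tr|rt] := leP t r; first by apply: aneg; rewrite at_.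
  by apply: bneg; rewrite ltW.
have sub t : a < t < b -> 0 < t < 1.
  by move=> /andP[at_ tb]; rewrite (le_lt_trans a0 at_) (lt_le_trans tb b1).
have dv t : 0 < t < 1 -> has_deriv v t (y t).
  move=> /andP[t0 t1]; have tI : 0 <= t <= 1 by rewrite !ltW.
  exact: (has_deriv_Z sg (has_deriv_axis_val sol tI)).
have dY t : 0 < t < 1 -> has_deriv (fun t => t ^+ n * y t) t ((1 - lam) * (t ^+ n * v t)).
  move=> tI; apply: (@has_deriv_near _ (fun t => sg * (t ^+ n * axis_der phi t))).
    by near=> u; rewrite mulrCA.
  apply: (has_deriv_val (has_deriv_Z sg (has_deriv_axis_flux rp sol tI))).
  by rewrite /v; ring.
have cY t : 0 <= t <= 1 -> {for t, continuous (fun t => t ^+ n * y t)}.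
  move=> tI; apply: (@continuous_atM R R (fun t => t ^+ n) y).
    exact: exprn_continuous.
  exact: cy.
exists v, y, a, b; split=> //; split; first by split=> //; exact: cw.
have [c cI [_ dc]] : exists2 c, c \in `]a, b[ & is_derive c 1 (fun t => t ^+ n * y t) 0.
  apply: (Rolle ab).
  - by move=> t; rewrite in_itv/= => /sub/dY[].
  - exact: cw.
  - by rewrite ya yb !mulr0.
move: cI; rewrite in_itv/= => cI; have cI' := sub c cI.
have vc : v c = 0.
  have [_] := dY c cI'; rewrite dc => /esym/eqP.
  rewrite mulf_eq0 subr_eq0 (lt_eqF lam1)/= mulf_eq0 expf_eq0 => /orP[/andP[_]|/eqP//].
  by rewrite gt_eqF//; case/andP: cI'.
have mono s1 t1 : a <= s1 -> s1 <= t1 -> t1 <= b -> v t1 <= v s1.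
  move=> as1 st tb1; rewrite -lerN2.
  apply: (le_derive_itv (F := fun t => - v t) (dF := fun t => - y t) st).
  - have cvst : {within `[s1, t1], continuous v}.
      by apply: cw => //; [exact: le_trans as1|exact: le_trans tb1 b1].
    by move=> t; apply: cvgN; exact: cvst.
  - move=> t; rewrite in_itv/= => /andP[s1t tt1].
    have tI : a < t < b by rewrite (le_lt_trans as1 s1t) (lt_le_trans tt1 tb1).
    apply: (@has_deriv_near _ (fun t => -1 * v t)); first by near=> u; rewrite mulN1r.
    by apply: (has_deriv_val (has_deriv_Z (-1) (dv t (sub _ tI)))); rewrite mulN1r.
  - move=> t; rewrite in_itv/= => /andP[s1t tt1]; rewrite oppr_ge0 ltW// neg//.
    by rewrite (le_lt_trans as1 s1t) (lt_le_trans tt1 tb1).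
have /andP[ac cb] := cI.
have va : v c <= v a by rewrite mono// ltW.
have vb : v b <= v c by rewrite mono// ltW.
by move: va vb; rewrite vc => va vb; exact: And5.
Unshelve. all: by end_near. Qed.

End RadialEigenvalues.

(** * Shooting *)

Section Shooting.
Variables (R : realType) (n : nat).
Implicit Types (f u Q : R -> R) (d r t lam : R).

(* With [Y = r^n v'] for the eigenfunction and [Phi = r^n u'], the function
   [f(u) Y + (lam - 1) v Phi] has derivative
   [u' Y (f'(u) + lam - 1) > 0], but it is [>= 0] at [a] and [<= 0] at [b]. *)
Lemma increasing_comparison lam f (df : R -> R) u Q (L : R) : 0 <= L ->
  (forall x y, `|f x - f y| <= L * `|x - y|) ->
  rad_eigenvalue n.+1 lam -> 1 < lam ->
  radial_profile n (f \o u) u Q ->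
  (forall r, 0 < r < 1 -> has_deriv f (u r) (df (u r)) /\ df (u r) < 1 - lam) ->
  ~ (forall r, 0 < r <= 1 -> 0 < Q r).
Proof.
move=> L0 Lf el lam1 p hdf Qpos.
have [v [y [a [b [[a0 ab b1] [[dv dY cv cY] [yneg ya yb va vb]]]]]]] :=
  eigen_decreasing_interval el lam1.
have sub t : a < t < b -> 0 < t < 1.
  by move=> /andP[at_ tb]; rewrite (le_lt_trans a0 at_) (lt_le_trans tb b1).
have [du _ _ _] := p.
pose Phi t := t ^+ n.+1 * Q t.
pose V t := f (u t) * (t ^+ n * y t) + (lam - 1) * (v t * Phi t).
pose dV t := t ^+ n.+1 * Q t * y t * (df (u t) + (lam - 1)).
have Phi0 t : 0 <= t <= 1 -> 0 <= Phi t.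
  move=> /andP[]; rewrite le_eqVlt => /predU1P[<- _|t0 t1].
    by rewrite /Phi expr0n mul0r.
  by rewrite mulr_ge0 ?exprn_ge0 ?ltW// Qpos// t0.
have : V a < V b.
  apply: (lt_derive_itv (dF := dV) ab).
  - move=> t; apply: cvgD.
      apply: cvgM; last exact: cY.
      have cfu : {within `[a, b], continuous (f \o u)}.
        apply: continuous_in_subspaceT => s; rewrite inE/= in_itv/= => /andP[as_ _].
        apply: continuous_comp; first exact: has_deriv_cont (du s (le_trans a0 as_)).
        exact: (lipschitz_continuous L0 Lf).
      exact: cfu.
    apply: cvgM; first exact: cvg_cst.
    by apply: cvgM; [exact: cv|exact: (flux_continuous p)].
  - move=> t; rewrite in_itv/= => tab; have tI := sub t tab.
    have [t0 t1] := andP tI; have [dfu _] := hdf t tI.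
    have d1 := has_deriv_comp (f := f) (g := u) dfu (du t (ltW t0)).
    have D := has_deriv_D (has_deriv_M d1 (dY t tI))
      (has_deriv_Z (lam - 1) (has_deriv_M (dv t tI) (has_deriv_flux p t0))).
    by apply: (has_deriv_val D); rewrite /dV /= exprS; ring.
  - move=> t; rewrite in_itv/= => tab; have tI := sub t tab.
    have [t0 t1] := andP tI; have [_ dfneg] := hdf t tI.
    rewrite /dV nmulr_lgt0; last by lra.
    rewrite pmulr_rlt0; first exact: yneg.
    by rewrite mulr_gt0 ?exprn_gt0// Qpos// t0 ltW.
rewrite /V ya yb !mulr0 !add0r; apply/negP; rewrite -leNgt.
rewrite ler_pM2l ?subr_gt0//; apply: (@le_trans _ _ 0).
  rewrite mulr_le0_ge0// Phi0// b1 (le_trans a0)//; exact: ltW.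
rewrite mulr_ge0// Phi0// a0 (le_trans _ b1)//; exact: ltW.
Qed.

(* Backward uniqueness at [rho]: with [Z = (u - u rho)^2 + u'^2], the function
   [Z e^(C r)] is nondecreasing on any [[e, rho]] and vanishes at [rho]. *)
Lemma radial_backward_unique f u Q (L rho e : R) : 0 <= L ->
  (forall x y, `|f x - f y| <= L * `|x - y|) ->
  radial_profile n (f \o u) u Q -> 0 < e -> e < rho ->
  Q rho = 0 -> f (u rho) = 0 -> Q e = 0.
Proof.
move=> L0 Lf p e0 er Qr fr; have [du _ cQ _] := p.
(* Each summand absorbs one term of [Z']: [1] the product [2 D y], [L] the term [2 y f(u)], and
   [2 n / e] the friction [2 n Q y]. The last one blows up at [0], which is why [e] stays
   positive. *)
pose C := 1 + L + 2 * n%:R / e.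
pose D t := u t - u rho.
pose y t := t * Q t.
pose Z t := D t * D t + y t * y t.
pose dZ t := 2 * D t * y t + 2 * y t * (f (u t) - n%:R * Q t).
pose W t := Z t * expR (C * t).
have dD t : 0 < t -> has_deriv D t (y t).
  move=> t0; apply: (has_deriv_val (has_deriv_B (du t (ltW t0)) (has_deriv_cst _ t))).
  by rewrite subr0.
have dy t : 0 < t -> has_deriv y t (f (u t) - n%:R * Q t).
  exact: (has_deriv_radial_der p).
have dW t : 0 < t -> has_deriv W t ((dZ t + C * Z t) * expR (C * t)).
  move=> t0; have d1 := has_deriv_D (has_deriv_M (dD t t0) (dD t t0))
    (has_deriv_M (dy t t0) (dy t t0)).
  apply: (has_deriv_val (has_deriv_M d1 (has_deriv_expR C t))).
  by rewrite /dZ /Z; ring.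
have : W e <= W rho.
  apply: (le_derive_itv (dF := fun t => (dZ t + C * Z t) * expR (C * t)) (ltW er)).
  - apply: (has_deriv_within (df := fun t => (dZ t + C * Z t) * expR (C * t))) => t et.
    exact: dW (lt_le_trans e0 et).
  - by move=> t; rewrite in_itv/= => /andP[et _]; exact: dW (lt_trans e0 et).
  - move=> t; rewrite in_itv/= => /andP[et _]; have t0 := lt_trans e0 et.
    rewrite mulr_ge0 ?expR_ge0//.
    have h1 : `|f (u t)| <= L * `|D t|.
      by rewrite -[f (u t)]subr0 -fr; exact: Lf.
    have h2 : 0 <= n%:R * (1 / e * (y t * y t) - y t * Q t).
      rewrite mulr_ge0// subr_ge0 /y.
      have -> : 1 / e * (t * Q t * (t * Q t)) = (t * (Q t * Q t)) * (t / e) by ring.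
      have -> : t * Q t * Q t = (t * (Q t * Q t)) * 1 by ring.
      apply: ler_wpM2l; first by rewrite mulr_ge0 ?(ltW t0)// -expr2 sqr_ge0.
      by rewrite ler_pdivlMr// mul1r ltW.
    have h3 : - (2 * y t * f (u t)) <= L * (D t * D t + y t * y t).
      apply: (@le_trans _ _ (2 * (`|y t| * (L * `|D t|)))).
        apply: le_trans (ler_norm _) _; rewrite normrN !normrM (ger0_norm (ler0n _ 2)).
        by rewrite -mulrA ler_wpM2l// ler_wpM2l.
      have -> : D t * D t + y t * y t = `|D t| ^+ 2 + `|y t| ^+ 2.
        by rewrite !real_normK ?num_real// !expr2.
      have h : 0 <= (`|D t| - `|y t|) ^+ 2 by exact: sqr_ge0.
      have -> : 2 * (`|y t| * (L * `|D t|)) = L * (2 * `|D t| * `|y t|) by ring.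
      by apply: ler_wpM2l => //; rewrite sqrrB -[_ *+ 2]mulr_natl mulrA in h; lra.
    have h4 : 0 <= D t * D t + 2 * D t * y t + y t * y t.
      have -> : D t * D t + 2 * D t * y t + y t * y t = (D t + y t) ^+ 2 by ring.
      exact: sqr_ge0.
    have h5 : 0 <= n%:R / e * (D t * D t).
      by rewrite mulr_ge0 ?divr_ge0 ?(ltW e0)// -expr2 sqr_ge0.
    rewrite /dZ /Z /C; move: h2 h3 h4 h5.
    set X := D t * D t; set Y := y t * y t.
    have -> : 2 * n%:R / e = 2 * (n%:R / e) by rewrite mulrA.
    have -> : n%:R * (1 / e * Y - y t * Q t) = n%:R / e * Y - n%:R * Q t * y t by ring.
    set m := n%:R / e.
    have -> : 2 * D t * y t + 2 * y t * (f (u t) - n%:R * Q t) + (1 + L + 2 * m) * (X + Y) =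
      2 * D t * y t + 2 * y t * f (u t) - 2 * (n%:R * Q t * y t) + X + Y
      + L * (X + Y) + 2 * (m * X) + 2 * (m * Y) by ring.
    by move=> ? ? ? ?; lra.
rewrite /W /Z /D /y subrr Qr !mulr0 addr0 mul0r.
rewrite pmulr_lle0 ?expR_gt0// -!expr2 => h.
have : (e * Q e) ^+ 2 <= 0 by apply: le_trans h; rewrite lerDr sqr_ge0.
by rewrite real_exprn_even_le0 ?num_real//= mulf_eq0 (gt_eqF e0)/= => /eqP.
Qed.

(** By the mean value property of the difference, [n.+1 (Q1 r - Q2 r)] equals [f (u1 s) - f (u2 s)]
    for some [s], so the bound on [u1 - u2] carries over. *)
Lemma radial_profile_q_dep f (L : R) u1 Q1 u2 Q2 : 0 <= L ->
  (forall x y, `|f x - f y| <= L * `|x - y|) ->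
  radial_profile n (f \o u1) u1 Q1 -> radial_profile n (f \o u2) u2 Q2 ->
  forall r, 0 <= r <= 1 ->
    `|Q1 r - Q2 r| <= L * (2 * expR (picard_rate L)) * `|u1 0 - u2 0|.
Proof.
move=> L0 Lf p1 p2 r /andP[r0 r1].
have [s sI e] : exists2 s, 0 <= s <= 1 &
    n.+1%:R * (Q1 r - Q2 r) = f (u1 s) - f (u2 s).
  have p := radial_profileB p1 p2.
  move: r0; rewrite le_eqVlt => /predU1P[<-|r0].
    by exists 0; [rewrite lexx ler01|case: p].
  have [s] := radial_profile_mean p r0; rewrite in_itv/= => /andP[s0 sr] e.
  by exists s => //; rewrite !ltW// (lt_le_trans sr).
apply: (@le_trans _ _ (n.+1%:R * `|Q1 r - Q2 r|)).
  by rewrite ler_peMl ?normr_ge0// ler1n.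
rewrite -[n.+1%:R]ger0_norm ?ler0n// -normrM e -mulrA.
apply: le_trans (Lf _ _) _; rewrite ler_wpM2l//.
exact: radial_ode_dep L0 Lf p1 p2 _ sI.
Qed.

Lemma radial_profile_cst f (s : R) : f s = 0 ->
  radial_profile n (f \o (fun=> s)) (fun=> s) (fun=> 0 : R).
Proof.
move=> fs; split=> [r _|r r0||]; last by rewrite mulr0 /= fs.
- by rewrite mulr0; exact: has_deriv_cst.
- by rewrite mulr0 subr0 /= fs mul0r; exact: has_deriv_cst.
- by move=> x; exact: cvg_cst.
Qed.

Lemma radial_profile_nondecreasing h u Q a b : radial_profile n h u Q ->
  (forall r, a < r < b -> 0 <= Q r) -> 0 <= a -> a <= b -> u a <= u b.
Proof.
move=> [du _ _ _] Q0 a0 ab.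
apply: (le_derive_itv (dF := fun t => t * Q t) ab).
- by apply: (has_deriv_within (df := fun t => t * Q t)) => t /(le_trans a0); exact: du.
- by move=> t; rewrite in_itv/= => /andP[at_ _]; exact: du (ltW (le_lt_trans a0 at_)).
- move=> t; rewrite in_itv/= => /andP[at_ tb]; rewrite mulr_ge0//.
    exact: ltW (le_lt_trans a0 at_).
  by rewrite Q0// at_.
Qed.

Variables (f df : R -> R) (L K ds u0 lam delta : R).
Hypotheses (L0 : 0 <= L) (Lf : forall x y, `|f x - f y| <= L * `|x - y|).
Hypotheses (K0 : 0 <= K) (fK : forall s, f s <= K).
Hypotheses (dsu0 : ds < u0) (fds : forall s, s <= ds -> f s = 0).
Hypotheses (fpos : forall s, ds < s < u0 -> 0 < f s) (fu0 : f u0 = 0).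
Hypotheses (el : rad_eigenvalue n.+1 lam) (lam1 : 1 < lam) (delta0 : 0 < delta).
Hypothesis hdf : forall s, `|s - u0| < delta -> has_deriv f s (df s) /\ df s < 1 - lam.

Lemma shooting : exists d u Q,
  [/\ ds < d < u0, u 0 = d & radial_profile n (f \o u) u Q] /\
  [/\ forall r, 0 <= r <= 1 -> 0 <= Q r, Q 1 = 0,
      forall r, 0 <= r <= 1 -> d <= u r <= u0 + K & u0 <= u 1].
Proof.
have [U HU] : exists U : R -> (R -> R) * (R -> R), forall d,
    (U d).1 0 = d /\ radial_profile n (f \o (U d).1) (U d).1 (U d).2.
  have H d : exists w : (R -> R) * (R -> R),
      w.1 0 = d /\ radial_profile n (f \o w.1) w.1 w.2.
    by have [v [q [v0 p]]] := radial_ode_exists n d L0 Lf; exists (v, q).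
  by have [U HU] := choice H; exists U.
have [m Hm] : exists m : R -> R, forall d, 0 <= m d <= 1 /\
    forall r, 0 <= r <= 1 -> (U d).2 (m d) <= (U d).2 r.
  have H d : exists r, 0 <= r <= 1 /\ forall t, 0 <= t <= 1 -> (U d).2 r <= (U d).2 t.
    have [_ [_ _ cQ _]] := HU d.
    have cQ01 : {within `[0, 1], continuous (U d).2} by exact: continuous_subspaceT.
    have [c] := EVT_min ler01 cQ01.
    by rewrite in_itv/= => cI cmin; exists c; split => // t tI; apply: cmin; rewrite in_itv.
  by have [m Hm] := choice H; exists m.
pose mu d := (U d).2 (m d).
pose B := 2 * expR (picard_rate L).
have B0 : 0 < B by rewrite mulr_gt0// expR_gt0.
(* Compare both [q] at the minimiser belonging to the smaller minimum. The minimisers themselves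
   need not vary continuously with [d]. *)
have mu_lip x y : `|mu x - mu y| <= L * B * `|x - y|.
  wlog le : x y / mu y <= mu x => [H|].
    by have [/H//|/ltW/H] := leP (mu y) (mu x); rewrite distrC (distrC y).
  have [mI mmin] := Hm x; have [mI' _] := Hm y.
  rewrite ger0_norm ?subr_ge0//.
  have [x0 px] := HU x; have [y0 py] := HU y.
  apply: (@le_trans _ _ ((U x).2 (m y) - (U y).2 (m y))).
    by rewrite lerD2r mmin.
  apply: le_trans (ler_norm _) _; rewrite -[in leRHS]x0 -[in leRHS]y0.
  exact: (radial_profile_q_dep L0 Lf px py mI').
have LB0 : 0 <= L * B by rewrite mulr_ge0// ltW.
have cmu : continuous mu by exact: lipschitz_continuous LB0 mu_lip.
(* close to the constant solution [ds], the solution stays below [u0] *)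
pose a1 := Num.min ((ds + u0) / 2) (ds + (u0 - ds) / (2 * B)).
have [dsa1 a1u0 a1B] : [/\ ds < a1, a1 < u0 & B * (a1 - ds) < u0 - ds].
  have h : 0 < (u0 - ds) / (2 * B) by apply: divr_gt0; [rewrite subr_gt0|exact: mulr_gt0].
  split.
  - by rewrite lt_min ltrDl h andbT (midf_lt dsu0).
  - by rewrite gt_min (midf_lt dsu0).
  - apply: (@le_lt_trans _ _ (B * ((u0 - ds) / (2 * B)))).
      rewrite ler_pM2l// lerBlDl ge_min; apply/orP; right; exact: lexx.
    have -> : B * ((u0 - ds) / (2 * B)) = (u0 - ds) / 2 by field; rewrite gt_eqF.
    by rewrite gtr_pMr ?subr_gt0// invf_lt1 ?ltr1n.
have mu_a1 : 0 < mu a1.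
  have [v0 p] := HU a1; have [mI _] := Hm a1.
  have below r : 0 <= r <= 1 -> (U a1).1 r < u0.
    move=> rI; have := radial_ode_dep L0 Lf p (radial_profile_cst (fds (lexx ds))) rI.
    rewrite v0 (@ger0_norm _ (a1 - ds)); last by rewrite subr_ge0 ltW.
    by rewrite ler_norml => /andP[_]; rewrite -/B; lra.
  (* A bootstrap: [f >= 0] below [u0] gives [q >= 0], so the solution stays above [a1 > ds], where
     [f > 0]; then the mean value property gives [q > 0]. *)
  have fge0 s : s < u0 -> 0 <= f s.
    by have [/fds -> //|h1 h2] := leP s ds; rewrite ltW// fpos// h1.
  have Qge0 r : 0 < r <= 1 -> 0 <= (U a1).2 r.
    move=> /andP[r0 r1]; have [s] := radial_profile_mean p r0.
    rewrite in_itv/= => /andP[s0 sr] e; rewrite -(@pmulr_rge0 _ n.+1%:R) ?ltr0n// e.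
    by apply: fge0; apply: below; rewrite !ltW// (lt_le_trans sr).
  have above r : 0 <= r <= 1 -> a1 <= (U a1).1 r.
    move=> /andP[r0 r1]; rewrite -[leLHS]v0.
    apply: (radial_profile_nondecreasing p) => // t /andP[t0 tr].
    by apply: Qge0; rewrite t0 (le_trans (ltW tr)).
  have fUpos r : 0 <= r <= 1 -> 0 < f ((U a1).1 r).
    by move=> rI; apply: fpos; rewrite below// andbT (lt_le_trans dsa1)// above.
  rewrite /mu; have /andP[] := mI; rewrite le_eqVlt => /predU1P[<- _|m0 m1].
    have [_ _ _ e] := p; rewrite -(@pmulr_rgt0 _ n.+1%:R) ?ltr0n// e.
    by apply: fUpos; rewrite lexx ler01.
  have [s] := radial_profile_mean p m0.
  rewrite in_itv/= => /andP[s0 sr] e; rewrite -(@pmulr_rgt0 _ n.+1%:R) ?ltr0n// e.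
  by apply: fUpos; rewrite !ltW// (lt_le_trans sr).
(* close to the constant solution [u0], the comparison lemma applies *)
pose b1 := Num.max a1 (u0 - delta / (2 * B)).
have hdB : 0 < delta / (2 * B) by apply: divr_gt0 => //; exact: mulr_gt0.
have a1b1 : a1 <= b1 by rewrite le_max lexx.
have b1u0 : b1 < u0 by rewrite gt_max a1u0/= ltrBlDr ltrDl.
have b1B : B * (u0 - b1) < delta.
  apply: (@le_lt_trans _ _ (B * (delta / (2 * B)))).
    by rewrite ler_pM2l// lerBlDr -lerBlDl le_max lexx orbT.
  have -> : B * (delta / (2 * B)) = delta / 2 by field; rewrite gt_eqF.
  by rewrite gtr_pMr// invf_lt1 ?ltr1n.
have mu_b1 : mu b1 <= 0.
  rewrite leNgt; apply/negP => mupos; have [v0 p] := HU b1; have [_ mmin] := Hm b1.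
  apply: (increasing_comparison (df := df) L0 Lf el lam1 p); last first.
    move=> r /andP[r0 r1]; apply: (lt_le_trans mupos); apply: mmin.
    by rewrite ltW.
  move=> r /andP[r0 r1]; apply: hdf; apply: le_lt_trans b1B.
  have rI : 0 <= r <= 1 by rewrite !ltW.
  have := radial_ode_dep L0 Lf p (radial_profile_cst fu0) rI.
  by rewrite v0 (distrC b1) (@ger0_norm _ (u0 - b1))// subr_ge0 ltW.
have cmu' : {within `[a1, b1], continuous mu} by exact: continuous_subspaceT.
have [|d dI mud] := @IVT R mu a1 b1 0 a1b1 cmu'.
  by rewrite ge_min mu_b1 orbT le_max (ltW mu_a1).
move: dI; rewrite in_itv/= => /andP[a1d db1].
have dsd : ds < d := lt_le_trans dsa1 a1d.
have du0 : d < u0 := le_lt_trans db1 b1u0.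
have [v0 p] := HU d; have [mI mmin] := Hm d.
exists d, (U d).1, (U d).2; move: mud mmin; rewrite /mu.
set u := (U d).1 in v0 p *; set Q := (U d).2 in p *; set rho := m d in mI *.
move=> Qrho; rewrite Qrho => Q0; have [dv dq cQ q0] := p.
have fd : 0 < f d by apply: fpos; rewrite dsd.
have Q00 : 0 < Q 0 by rewrite -(@pmulr_rgt0 _ n.+1%:R) ?ltr0n// q0 /= v0.
have rho0 : 0 < rho.
  have /andP[r0 _] := mI; rewrite lt_neqAle r0 andbT.
  apply: contraTneq Q00 => r00; move: Qrho; rewrite -r00 => ->.
  by rewrite ltxx.
have rho1 : rho = 1.
  (* At an interior minimum [q = q' = 0], so the equation for [q] forces [f (u rho) = 0]. Backward
     uniqueness then gives [q = 0] near [0], against [q(0) > 0]. *)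
  have /andP[_ r1] := mI; apply/eqP; rewrite eq_le r1/= leNgt; apply/negP => rlt1.
  have [_ e0] : is_derive rho 1 Q 0.
    apply: (@derive1_at_min _ Q 0 1 rho ler01).
    - by move=> t; rewrite in_itv/= => /andP[t0 _]; have [] := dq t t0.
    - by rewrite in_itv/= rho0.
    - move=> t; rewrite in_itv/= Qrho => /andP[t0 t1]; apply: Q0.
      by rewrite !ltW.
  have [_] := dq rho rho0; rewrite e0 Qrho mulr0 subr0 => /esym/eqP.
  rewrite mulf_eq0 invr_eq0 (gt_eqF rho0) orbF => /eqP frho.
  have H : \forall t \near 0^'+, 0 < Q t.
    have H0 : \forall t \near (0 : R), 0 < Q t by exact: (cQ 0 _ (lt_nbhsr Q00)).
    by apply: cvg_within H0.
  near (0 : R)^'+ => e.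
  have eQ : 0 < Q e by near: e.
  have e0' : 0 < e by near: e; exact: nbhs_right_gt.
  have er : e < rho by near: e; exact: nbhs_right_lt.
  have Qe := radial_backward_unique L0 Lf p e0' er Qrho frho.
  by move: (gt_eqF eQ); rewrite Qe eqxx.
have Q1 : Q 1 = 0 by rewrite -rho1.
have low r : 0 <= r <= 1 -> d <= u r.
  move=> /andP[r0 r1]; rewrite -[leLHS]v0.
  apply: (radial_profile_nondecreasing p) => // t /andP[t0 tr].
  by apply: Q0; rewrite ltW//= (le_trans (ltW tr)).
have mono s t : 0 <= s -> s <= t -> t <= 1 -> u s <= u t.
  move=> s0 st t1; apply: (radial_profile_nondecreasing p) => // x /andP[sx xt].
  by apply: Q0; rewrite (le_trans s0 (ltW sx)) (le_trans (ltW xt)).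
split; split => //.
- by rewrite dsd.
- move=> r rI; rewrite low//=; have /andP[r0 r1] := rI.
  (* As [n.+1 q] is a value of [f], it is at most [K]; then [u' = r q <= K] on [[0, 1]]. The
     resulting bound does not involve [L]. *)
  have QK t : 0 < t -> Q t <= K.
    move=> t0; have [s _ e] := radial_profile_mean p t0.
    have N1 : 1 <= n.+1%:R :> R by rewrite ler1n.
    have : n.+1%:R * Q t <= K by rewrite e; exact: fK.
    have [Qt|Qt] := leP 0 (Q t); last by move=> _; apply: le_trans (ltW Qt) K0.
    by apply: le_trans; rewrite ler_peMl.
  have : d + K * 0 - u 0 <= d + K * r - u r.
    apply: (le_derive_itv (F := fun t => d + K * t - u t) (dF := fun t => K - t * Q t) r0).
    - apply: (has_deriv_within (df := fun t => K - t * Q t)) => t t0.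
      apply: (has_deriv_val (has_deriv_B (has_deriv_D (has_deriv_cst d t)
        (has_deriv_Z K (has_deriv_id t))) (dv t t0))).
      by rewrite mulr1 add0r.
    - move=> t; rewrite in_itv/= => /andP[t0 _].
      apply: (has_deriv_val (has_deriv_B (has_deriv_D (has_deriv_cst d t)
        (has_deriv_Z K (has_deriv_id t))) (dv t (ltW t0)))).
      by rewrite mulr1 add0r.
    - move=> t; rewrite in_itv/= => /andP[t0 tr]; rewrite subr_ge0.
      have t1 : t <= 1 := le_trans (ltW tr) r1.
      by apply: le_trans (ler_wpM2l (ltW t0) (QK t t0)) _; rewrite ler_piMl.
  have : K * r <= K by rewrite ler_piMr.
  by rewrite mulr0 addr0 v0; lra.
(* [Q 1 = 0] makes some [u s] a zero of [f]. Since [u s >= d > ds], this zero is at least [u0], and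
   so is [u 1]. *)
- have [s] := radial_profile_mean p ltr01; rewrite in_itv/= => /andP[s0 s1].
  rewrite Q1 mulr0 /= => /esym fs.
  apply: le_trans (mono s 1 (ltW s0) (ltW s1) (lexx _)).
  rewrite leNgt; apply/negP => us; move: (@fpos (u s)); rewrite us fs ltxx andbT.
  by move=> /(_ (lt_le_trans dsd (low s _))) H; have := H _; rewrite !ltW// => /(_ isT).
Unshelve. all: by end_near. Qed.

End Shooting.

(** * The solutions *)

Section Nonlinearity.
Variables (R : realType) (g g' : R -> R).
Hypothesis hC1 : C1_halfline g g'.

Lemma C1_halfline_deriv s : 0 < s -> has_deriv (fun s => s - g s) s (1 - g' s).
Proof.
by have [dg _] := hC1; move=> s0; exact: has_deriv_B (has_deriv_id s) (dg s s0).
Qed.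

Lemma C1_halfline_cvg0 : g h @[h --> 0^'+] --> g 0.
Proof.
have [_ [d0 _]] := hC1.
have id0 : (h : R) @[h --> 0^'+] --> (0 : R) by apply: cvg_at_right_filter; exact: cvg_id.
have H : (h * (h^-1 * (g h - g 0)) + g 0) @[h --> 0^'+] --> 0 * g' 0 + g 0.
  by apply: cvgD; [exact: (cvgM id0 d0)|exact: cvg_cst].
move: H; rewrite mul0r add0r; apply: cvg_trans; apply: near_eq_cvg; near=> h.
have h0 : h != 0 by rewrite gt_eqF//; near: h; exact: nbhs_right_gt.
by rewrite /= mulVKf ?subrK.
Unshelve. all: by end_near. Qed.

(** Makes [0] a zero of [s - g s], the starting point of the search for [ds]. *)
Lemma C1_halfline_at0 (l : R) : g s / s @[s --> 0^'+] --> l -> g 0 = 0.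
Proof.
move=> gl; have id0 : (h : R) @[h --> 0^'+] --> (0 : R).
  by apply: cvg_at_right_filter; exact: cvg_id.
have H : (g h / h * h) @[h --> 0^'+] --> l * 0 by exact: (cvgM gl id0).
move: H; rewrite mulr0 => H.
apply: (cvg_unique _ C1_halfline_cvg0) => //.
move: H; apply: cvg_trans; apply: near_eq_cvg; near=> h.
have h0 : h != 0 by rewrite gt_eqF//; near: h; exact: nbhs_right_gt.
by rewrite /= divfK.
Unshelve. all: by end_near. Qed.

Lemma C1_halfline_within a b : 0 <= a -> a < b ->
  {within `[a, b], continuous (fun s => s - g s)}.
Proof.
move=> a0 ab; have c s : 0 < s -> {for s, continuous (fun s => s - g s)}.
  by move=> s0; exact: has_deriv_cont (C1_halfline_deriv s0).
apply/continuous_within_itvP => //; split.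
- by move=> s; rewrite in_itv/= => /andP[as_ _]; apply: c (le_lt_trans a0 as_).
- move: a0; rewrite le_eqVlt => /predU1P[<-|a0]; last by apply: cvg_at_right_filter; exact: c.
  apply: cvgB; last exact: C1_halfline_cvg0.
  by apply: cvg_at_right_filter; exact: cvg_id.
- by apply: cvg_at_left_filter; exact: c (le_lt_trans a0 ab).
Qed.

Lemma C1_halfline_lipschitz a b : 0 <= a -> a < b ->
  exists2 L : R, 0 <= L & forall x y,
    `|(clamp a b x - g (clamp a b x)) - (clamp a b y - g (clamp a b y))| <= L * `|x - y|.
Proof.
move=> a0 ab; have [_ [_ cg']] := hC1.
have cd : {within `[a, b], continuous (fun s => `|1 - g' s|)}.
  have cg'' : {within `[a, b], continuous g'}.
    apply: continuous_subspaceW cg' => s /=; rewrite in_itv/= => /andP[as_ _].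
    exact: le_trans as_.
  move=> s; apply: cvg_norm; apply: cvgB; [exact: cvg_cst|exact: cg''].
have [m _ hm] := EVT_max (ltW ab) cd.
exists `|1 - g' m|; first exact: normr_ge0.
move=> x y; apply: (@le_trans _ _ (`|1 - g' m| * `|clamp a b x - clamp a b y|)); last first.
  by rewrite ler_wpM2l// clamp_dist// ltW.
have := clamp_itv x (ltW ab); have := clamp_itv y (ltW ab).
move: (clamp a b x) (clamp a b y) => {}x {}y.
wlog xy : x y / y <= x => [H yI xI|].
  have [/H|/ltW/H] := leP y x; first exact.
  by rewrite distrC (distrC x); apply.
move=> /andP[ay yb] /andP[ax xb]; move: xy; rewrite le_eqVlt => /predU1P[->|xy].
  by rewrite !subrr normr0 mulr0.
have dF s : s \in `]y, x[ -> is_derive s 1 (fun s => s - g s) (1 - g' s).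
  rewrite in_itv/= => /andP[ys _]; apply: C1_halfline_deriv.
  exact: le_lt_trans (le_trans a0 ay) ys.
have [c] := MVT xy dF (C1_halfline_within (le_trans a0 ay) xy).
rewrite in_itv/= => /andP[yc cx] ->.
by rewrite normrM ler_wpM2r// hm// in_itv/= (ltW (le_lt_trans ay yc)) (ltW (lt_le_trans cx xb)).
Qed.

(** For large [s], [g s >= c s >= s]; what remains is a compact interval. *)
Lemma superlinear_bounded : (exists c : R, 1 < c /\ \forall s \near +oo, c <= g s / s) ->
  exists2 K : R, 0 <= K & forall s, 0 <= s -> s - g s <= K.
Proof.
move=> [c [c1 [M [_ hM]]]].
pose M1 := Num.max M 1.
have M10 : 0 < M1 by rewrite lt_max ltr01 orbT.
have [m _ hm] := EVT_max (ltW M10) (C1_halfline_within (lexx 0) M10).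
exists (Num.max 0 (m - g m)); first by rewrite le_max lexx.
move=> s s0; rewrite le_max; have [sM|Ms] := leP s M1.
  by apply/orP; right; apply: hm; rewrite in_itv/= s0.
apply/orP; left.
have {}s0 : 0 < s := lt_trans M10 Ms.
have /hM : M < s by apply: le_lt_trans Ms; rewrite le_max lexx.
rewrite ler_pdivlMr// => h; rewrite subr_le0; apply: le_trans h.
by rewrite ler_peMl ?ltW.
Qed.

Lemma derivative_above (u0 lam : R) : 0 < u0 -> lam < g' u0 ->
  exists2 d : R, 0 < d & forall s, `|s - u0| < d -> 0 < s /\ lam < g' s.
Proof.
move=> u00 lamg; have [_ [_ /subspace_continuousP cg']] := hC1.
have H0 : \forall s \near u0, 0 < s by exact: lt_nbhsr.
have H1 : \forall s \near u0, [set s : R | 0 <= s] s -> lam < g' s.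
  exact: (cg' u0 (ltW u00) _ (lt_nbhsr lamg)).
have : \forall s \near u0, 0 < s /\ lam < g' s.
  near=> s; have s0 : 0 < s by near: s.
  have H1s : [set s : R | 0 <= s] s -> lam < g' s by near: s.
  by split => //; apply/H1s/ltW.
move=> /nbhs_normP[d d0 hd]; exists d => // s sd; apply: hd.
by rewrite /= distrC.
Unshelve. all: by end_near. Qed.

Variables (n : nat) (u0 : R).
Hypotheses (g1 : exists l : R, 0 <= l /\ l < 1 /\ (fun s : R => g s / s) @ 0^'+ --> l)
  (g2 : exists c : R, 1 < c /\ \forall s \near +oo, c <= g s / s)
  (u00 : 0 < u0) (gu0 : g u0 = u0) (lu0 : lambda2_rad R n.+1 < g' u0).

Lemma increasing_solution_below : exists ds d (sol : 'rV[R]_n.+1 -> R),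
  [/\ ds < d, d < u0, forall s, ds < s < u0 -> g s < s, sol 0 = d &
      incr_rad_pos_sol g sol].
Proof.
have [lam [el lam1 lamg]] := lambda2_rad_lt lu0.
have [dl dl0 hdl] := derivative_above u00 lamg.
have [K K0 hK] := superlinear_bounded g2.
pose f0 s := s - g s.
have f00 : f0 0 = 0.
  by have [l [_ [_ gl]]] := g1; rewrite /f0 (C1_halfline_at0 gl) subrr.
have f0u0 : f0 u0 = 0 by rewrite /f0 gu0 subrr.
have near_pos s : u0 - dl < s < u0 -> 0 < f0 s.
  move=> /andP[s1 s2]; have sd : `|s - u0| < dl.
    by rewrite distrC ger0_norm ?subr_ge0 ?ltW// ltrBlDr -ltrBlDl.
  have [s0 _] := hdl s sd; rewrite -oppr_lt0 -[ltRHS]oppr0 -f0u0.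
  apply: (lt_derive_itv (F := fun t => - f0 t) (dF := fun t => - (1 - g' t)) s2).
  - by have cf := C1_halfline_within (ltW s0) s2 => t; apply: cvgN; exact: cf.
  - move=> t; rewrite in_itv/= => /andP[st _].
    apply: (@has_deriv_near _ (fun t => -1 * f0 t)); first by near=> x; rewrite mulN1r.
    have dt := C1_halfline_deriv (lt_trans s0 st).
    by apply: (has_deriv_val (has_deriv_Z (-1) dt)); rewrite mulN1r.
  - move=> t; rewrite in_itv/= => /andP[st tu].
    have [|_] := hdl t; last by move: lam1; lra.
    rewrite distrC ger0_norm ?subr_ge0 ?ltW// ltrBlDr -ltrBlDl.
    exact: lt_trans st.
(* [last_zero] needs a point of strict sign, and [u0] is itself a zero of [f0]; so the search goes
   back from [t0]. *)
pose t0 := u0 - dl / 2.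
have dl2 : 0 < dl / 2 by rewrite divr_gt0.
have t0u0 : t0 < u0 by rewrite /t0 ltrBlDr ltrDl.
have t0dl : u0 - dl < t0 by rewrite /t0 ltrD2l ltrN2 gtr_pMr// invf_lt1 ?ltr1n.
have t0pos : 0 < t0.
  have [|//] := hdl t0; rewrite distrC ger0_norm ?subr_ge0 ?ltW//.
  by rewrite ltrBlDr -ltrBlDl.
have f0t0 : - f0 t0 < 0 by rewrite oppr_lt0 near_pos// t0dl.
have cNf : {within `[0, t0], continuous (fun t => - f0 t)}.
  by have cf := C1_halfline_within (lexx 0) t0pos => t; apply: cvgN; exact: cf.
have Nf00 : - f0 0 = 0 by rewrite f00 oppr0.
have [ds [ds0 dst0 /eqP]] := last_zero t0pos cNf Nf00 f0t0.
rewrite oppr_eq0 => /eqP f0ds fneg.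
have dsu0 : ds < u0 := lt_trans dst0 t0u0.
have f0pos s : ds < s < u0 -> 0 < f0 s.
  move=> /andP[ds_s su0]; have [st|ts] := leP s t0.
    by rewrite -oppr_lt0; apply: fneg; rewrite ds_s.
  by apply: near_pos; rewrite su0 (lt_trans t0dl).
(* [u0 + K] is the a priori bound on the solution; the extra [1] leaves room to the right of
   [u0]. *)
pose M := u0 + K + 1.
have u0M : u0 < M by rewrite /M; move: K0; lra.
have dsM : ds < M := lt_trans dsu0 u0M.
pose f s := clamp ds M s - g (clamp ds M s).
have fE s : ds <= s <= M -> f s = f0 s by move=> sI; rewrite /f clamp_id.
have [L L0 Lf] := C1_halfline_lipschitz ds0 dsM.
have fK s : f s <= K.
  apply: hK; have /andP[+ _] := clamp_itv s (ltW dsM); exact: le_trans.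
have fds s : s <= ds -> f s = 0.
  move=> sds; rewrite -f0ds /f /f0; suff -> : clamp ds M s = ds by [].
  by rewrite /clamp (min_idPl (le_trans sds (ltW dsM))) (max_idPl sds).
have fpos s : ds < s < u0 -> 0 < f s.
  move=> sI; have /andP[s1 s2] := sI; rewrite fE ?f0pos//.
  by rewrite (ltW s1) (ltW (lt_trans s2 u0M)).
have fu0 : f u0 = 0 by rewrite fE ?f0u0// !ltW.
(* [dl / 2] keeps [s] above [t0 > ds] and [1] keeps it below [M], so [f] and [f0] agree around
   [s]. *)
pose delta := Num.min (dl / 2) 1.
have delta0 : 0 < delta by rewrite lt_min dl2 ltr01.
have hdf s : `|s - u0| < delta -> has_deriv f s (1 - g' s) /\ 1 - g' s < 1 - lam.
  rewrite lt_min => /andP[sd s1].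
  have [s0 lg] : 0 < s /\ lam < g' s.
    by apply: hdl; apply: lt_trans sd _; rewrite gtr_pMr// invf_lt1 ?ltr1n.
  split; last by rewrite ltrD2l ltrN2.
  apply: (@has_deriv_near _ f0); last exact: C1_halfline_deriv.
  move: sd s1; rewrite !ltr_norml => /andP[sd _] /andP[_ s1].
  have dss : ds < s by apply: (lt_trans dst0); rewrite /t0; move: sd; lra.
  have sM : s < M by rewrite /M; move: K0 s1; lra.
  near=> t; rewrite fE//; apply/andP; split; apply/ltW; near: t.
    exact: lt_nbhsr.
  exact: lt_nbhsl.
have [d [u [Q [[dI u00' p] [Q0 Q1 ub u1]]]]] :=
  shooting L0 Lf K0 fK dsu0 fds fpos fu0 el lam1 delta0 hdf.
have /andP[dsd du0] := dI; have [du _ _ _] := p.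
have cf : continuous f := lipschitz_continuous L0 Lf.
exists ds, d, (fun x => u (eucl x)); split => //.
- by move=> s /f0pos; rewrite subr_gt0.
- by rewrite eucl0.
have mono r s : 0 <= r -> r <= s -> s <= 1 -> u r <= u s.
  move=> r0 rs s1; apply: (radial_profile_nondecreasing p) => // x /andP[rx xs].
  by apply: Q0; rewrite (le_trans r0 (ltW rx)) (le_trans (ltW xs)).
split; [|split].
- apply: (lift_neumann p) => //.
    by move=> r r0; apply: continuous_comp; [exact: has_deriv_cont (du r r0)|exact: cf].
  move=> r /andP[r0 r1]; have /andP[h1 h2] : d <= u r <= u0 + K by rewrite ub// r0 ltW.
  have uI : ds <= u r <= M by rewrite (le_trans (ltW dsd) h1)/= (le_trans h2)// /M lerDl.
  exact: fE uI.
- move=> x xB; have : d <= u (eucl x).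
    have /andP[] // : d <= u (eucl x) <= u0 + K.
    by apply: ub; rewrite eucl_ge0 eucl_le1//; exact: ltW.
  by apply: lt_le_trans; exact: le_lt_trans ds0 dsd.
- exists u; split=> //; split=> //; exists 0, 1.
  by rewrite lexx ler01 u00' lt_eqF// (lt_le_trans du0).
Unshelve. all: by end_near. Qed.

End Nonlinearity.
Unset Implicit Arguments.

Theorem theorem1p2 (R : realType) (N : nat) (hN : (0 < N)%N)
  (g g' : R -> R) (hC1 : C1_halfline g g')
  (g1 : exists l : R, 0 <= l /\ l < 1 /\ (fun s : R => g s / s) @ 0^'+ --> l)
  (g2 : exists c : R, 1 < c /\ \forall s \near +oo, c <= g s / s) :
  ((exists u0 : R, 0 < u0 /\ g u0 = u0 /\ lambda2_rad R N < g' u0) ->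
     exists u : 'rV[R]_N -> R, incr_rad_pos_sol g u)
  /\
  (forall (n : nat) (u0 : 'I_n -> R),
     injective u0 ->
     (forall i, 0 < u0 i /\ g (u0 i) = u0 i /\ lambda2_rad R N < g' (u0 i)) ->
     exists sol : 'I_n -> ('rV[R]_N -> R),
       (forall i, incr_rad_pos_sol g (sol i)) /\
       (forall i j, i != j -> exists x, ball_B x /\ sol i x != sol j x)).
Proof.
case: N hN => // N _; split.
  move=> [u0 [u00 [gu0 lu0]]].
  have [ds [d [sol [_ _ _ _ H]]]] := increasing_solution_below hC1 g1 g2 u00 gu0 lu0.
  by exists sol.
move=> n u0 inj H.
have Hi i : exists w : R * R * ('rV[R]_N.+1 -> R),
    [/\ w.1.1 < w.1.2, w.1.2 < u0 i, forall s, w.1.1 < s < u0 i -> g s < s,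
        w.2 0 = w.1.2 & incr_rad_pos_sol g w.2].
  have [u00 [gu0 lu0]] := H i.
  have [ds [d [sol Hs]]] := increasing_solution_below hC1 g1 g2 u00 gu0 lu0.
  by exists (ds, d, sol).
have [w Hw] := choice Hi.
exists (fun i => (w i).2); split; first by move=> i; have [] := Hw i.
(* A fixed point of [g] cannot lie strictly between the [ds] of [j] and [u0 j], so [u0 i] is at most
   that [ds], which separates the two starting values. *)
have lt_sol i j : u0 i < u0 j -> (w i).2 0 < (w j).2 0.
  move=> ij; have [_ di _ -> _] := Hw i; have [dj _ gj -> _] := Hw j.
  apply: (lt_trans di); apply: le_lt_trans dj; rewrite leNgt; apply/negP => uj.
  have [_ [gu _]] := H i.
  by have := gj (u0 i); rewrite uj ij gu ltxx => /(_ isT).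
move=> i j ij; exists 0; split; first by rewrite /ball_B/= sqnorm0.
have [/lt_sol h|/lt_sol h|/inj e] := ltgtP (u0 i) (u0 j).
- by rewrite lt_eqF.
- by rewrite gt_eqF.
- by rewrite e eqxx in ij.
Qed.
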